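(* For every integer $n \geq 0$ there exists a simple $\upsilon$-reduction grammar $\mathscr{G}_n$ (as defined in the context), and such a grammar can be effectively constructed (computed) from $n$.
   Context: $\lambda\upsilon$-terms (de Bruijn notation) are generated by: terms $t ::= \underline{n} \mid \lambda t \mid t\,t \mid t[s]$; substitutions $s ::= t/ \mid \Uparrow(s) \mid\ \uparrow$; indices $\underline{n} ::= \underline{0} \mid \mathtt{S}\,\underline{n}$ (successor). The $\upsilon$-rewriting rules are: $(a b)[s] \to a[s](b[s])$; $(\lambda a)[s] \to \lambda(a[\Uparrow(s)])$; $\underline{0}[a/] \to a$; $(\mathtt{S}\,\underline{n})[a/] \to \underline{n}$; $\underline{0}[\Uparrow(s)] \to \underline{0}$; $(\mathtt{S}\,\underline{n})[\Uparrow(s)] \to \underline{n}[s][\uparrow]$; $\underline{n}[\uparrow] \to \mathtt{S}\,\underline{n}$. (The $\upsilon$-fragment is terminating.) A term normalises in $k$ steps if the normal-order (leftmost-outermost) $\upsilon$-reduction reaches a $\upsilon$-normal form in exactly $k$ steps. Regular tree grammars: over the ranked alphabet $\mathscr{F}$ of $\lambda\upsilon$ symbols (application and closure $\cdot[\cdot]$ binary; $\lambda$, slash $\cdot/$, lift $\Uparrow$, successor $\mathtt{S}$ unary; $\uparrow$, $\underline{0}$ constants), $\mathscr{T}_{\mathscr{F}}(X)$ denotes terms over $\mathscr{F}$ with variables (non-terminals) in $X$. A regular tree grammar $(A,\mathscr{N},\mathscr{F},\mathscr{P})$ has axiom $A\in\mathscr{N}$, finite set of non-terminals $\mathscr{N}$,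 and finitely many productions $X \to \alpha$ with $X\in\mathscr{N}$, $\alpha \in \mathscr{T}_{\mathscr{F}}(\mathscr{N})$; derivation replaces one occurrence of a non-terminal $X$ by $\alpha$ for a production $X\to\alpha$. $L(\alpha)$ is the set of ground terms derivable from $\alpha$. A non-terminal $X$ is unambiguous if every ground term has at most one derivation sequence from $X$. A production $X\to\alpha$ is self-referencing if $X$ occurs in $\alpha$, and regular otherwise. Let $\Lambda$ be the grammar with non-terminals $T,S,N$ and productions $T \to N \mid \lambda T \mid T T \mid T[S]$, $S \to T/ \mid \Uparrow(S) \mid \uparrow$, $N \to \underline{0} \mid \mathtt{S} N$ (so $L(T)$, $L(S)$, $L(N)$ are all $\lambda\upsilon$-terms, substitutions, indices). A $\upsilon$-reduction grammar ($\upsilon$-RG) is a regular tree grammar $\mathscr{G}_n = (G_n, \{T,S,N,G_0,\dots,G_n\}, \mathscr{F}, \mathscr{P}_n)$ whose productions include those of $\Lambda$, such that for each $0\le k\le n$ the non-terminal $G_k$ is unambiguous in $\mathscr{G}_n$ and $L(G_k)$ equals the set of $\lambda\upsilon$-terms that normalise in exactly $k$ normal-order $\upsilon$-steps. It is simple if all its self-referencing productions are either productions of $\Lambda$ or of the form $G_k \to \lambda G_k \mid G_0 G_k \mid G_k G_0$, and for every regular production $G_k \to \alpha$ one has $\alpha \in \mathscr{T}_{\mathscr{F}}(\{T,S,N,G_0,\dots,G_{k-1}\})$. *)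

(* Defs.v *)
From Stdlib Require Import List Arith.
Import ListNotations.

(* application, closure  t[s]  : binary
   lambda, slash  t/ , lift  (Uparrow s), successor S : unary
   shift (uparrow), index 0 : constants *)
Inductive tm (X : Type) : Type :=
| Var   : X -> tm X
| App   : tm X -> tm X -> tm X
| Clos  : tm X -> tm X -> tm X
| Lam   : tm X -> tm X
| Slash : tm X -> tm X
| Lift  : tm X -> tm X
| Succ  : tm X -> tm X
| Shift : tm X
| Zero  : tm X.
Arguments Var {X}. Arguments App {X}. Arguments Clos {X}. Arguments Lam {X}.
Arguments Slash {X}. Arguments Lift {X}. Arguments Succ {X}.
Arguments Shift {X}. Arguments Zero {X}.

Inductive novar : Type := .
Definition gtm := tm novar.

Inductive is_index : gtm -> Prop :=
| ix_zero : is_index Zero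
| ix_succ n : is_index n -> is_index (Succ n).

Inductive is_term : gtm -> Prop :=
| tm_idx n : is_index n -> is_term n
| tm_lam a : is_term a -> is_term (Lam a)
| tm_app a b : is_term a -> is_term b -> is_term (App a b)
| tm_clos a s : is_term a -> is_subst s -> is_term (Clos a s)
with is_subst : gtm -> Prop :=
| sb_slash a : is_term a -> is_subst (Slash a)
| sb_lift s : is_subst s -> is_subst (Lift s)
| sb_shift : is_subst Shift.

Inductive root_step : gtm -> gtm -> Prop :=
| r_app a b s : root_step (Clos (App a b) s) (App (Clos a s) (Clos b s))
| r_lam a s : root_step (Clos (Lam a) s) (Lam (Clos a (Lift s)))
| r_zero_slash a : root_step (Clos Zero (Slash a)) a
| r_succ_slash n a : is_index n -> root_step (Clos (Succ n) (Slash a)) n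
| r_zero_lift s : root_step (Clos Zero (Lift s)) Zero
| r_succ_lift n s : is_index n ->
    root_step (Clos (Succ n) (Lift s)) (Clos (Clos n s) Shift)
| r_shift n : is_index n -> root_step (Clos n Shift) (Succ n).

Definition is_redex (t : gtm) : Prop := exists u, root_step t u.

Inductive step : gtm -> gtm -> Prop :=
| st_root t u : root_step t u -> step t u
| st_app_l a a' b : step a a' -> step (App a b) (App a' b)
| st_app_r a b b' : step b b' -> step (App a b) (App a b')
| st_clos_l a a' s : step a a' -> step (Clos a s) (Clos a' s)
| st_clos_r a s s' : step s s' -> step (Clos a s) (Clos a s')
| st_lam a a' : step a a' -> step (Lam a) (Lam a')
| st_slash a a' : step a a' -> step (Slash a) (Slash a')
| st_lift a a' : step a a' -> step (Lift a) (Lift a')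
| st_succ a a' : step a a' -> step (Succ a) (Succ a').

Definition normal (t : gtm) : Prop := forall u, ~ step t u.

Inductive nstep : gtm -> gtm -> Prop :=
| ns_root t u : root_step t u -> nstep t u
| ns_app_l a a' b : ~ is_redex (App a b) -> nstep a a' ->
    nstep (App a b) (App a' b)
| ns_app_r a b b' : ~ is_redex (App a b) -> normal a -> nstep b b' ->
    nstep (App a b) (App a b')
| ns_clos_l a a' s : ~ is_redex (Clos a s) -> nstep a a' ->
    nstep (Clos a s) (Clos a' s)
| ns_clos_r a s s' : ~ is_redex (Clos a s) -> normal a -> nstep s s' ->
    nstep (Clos a s) (Clos a s')
| ns_lam a a' : ~ is_redex (Lam a) -> nstep a a' -> nstep (Lam a) (Lam a')
| ns_slash a a' : ~ is_redex (Slash a) -> nstep a a' -> nstep (Slash a) (Slash a')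
| ns_lift a a' : ~ is_redex (Lift a) -> nstep a a' -> nstep (Lift a) (Lift a')
| ns_succ a a' : ~ is_redex (Succ a) -> nstep a a' -> nstep (Succ a) (Succ a').

Inductive nsteps : nat -> gtm -> gtm -> Prop :=
| nss_0 t : nsteps 0 t t
| nss_S k t u v : nstep t u -> nsteps k u v -> nsteps (S k) t v.

Definition normalises_in (k : nat) (t : gtm) : Prop :=
  is_term t /\ exists u, nsteps k t u /\ normal u.

Inductive nt : Type := NT | NS | NN | NG (k : nat).

Definition nt_eq_dec (x y : nt) : {x = y} + {x <> y}.
Proof. decide equality; apply Nat.eq_dec. Defined.

Definition tm_eq_dec (a b : tm nt) : {a = b} + {a <> b}.
Proof. decide equality; apply nt_eq_dec. Defined.

Definition prod_eq_dec (p q : nt * tm nt) : {p = q} + {p <> q}.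
Proof. decide equality; [apply tm_eq_dec | apply nt_eq_dec]. Defined.

Definition productions := list (nt * tm nt).

(** Boolean membership (proofs of [inb p P = true] are unique, so a derivation
    is determined by the productions it uses). *)
Definition inb (p : nt * tm nt) (P : productions) : bool :=
  if in_dec prod_eq_dec p P then true else false.

Inductive deriv (P : productions) : tm nt -> gtm -> Type :=
| d_var X beta t : inb (X, beta) P = true -> deriv P beta t -> deriv P (Var X) t
| d_app a b u v : deriv P a u -> deriv P b v -> deriv P (App a b) (App u v)
| d_clos a b u v : deriv P a u -> deriv P b v -> deriv P (Clos a b) (Clos u v)
| d_lam a u : deriv P a u -> deriv P (Lam a) (Lam u)
| d_slash a u : deriv P a u -> deriv P (Slash a) (Slash u)
| d_lift a u : deriv P a u -> deriv P (Lift a) (Lift u)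
| d_succ a u : deriv P a u -> deriv P (Succ a) (Succ u)
| d_shift : deriv P Shift Shift
| d_zero : deriv P Zero Zero.

Definition lang (P : productions) (alpha : tm nt) (t : gtm) : Prop :=
  inhabited (deriv P alpha t).

Definition unambiguous (P : productions) (X : nt) : Prop :=
  forall t (d1 d2 : deriv P (Var X) t), d1 = d2.

Fixpoint occurs (X : nt) (a : tm nt) : Prop :=
  match a with
  | Var Y => X = Y
  | App a b | Clos a b => occurs X a \/ occurs X b
  | Lam a | Slash a | Lift a | Succ a => occurs X a
  | Shift | Zero => False
  end.

Definition Lambda_prods : productions :=
  [ (NT, Var NN); (NT, Lam (Var NT)); (NT, App (Var NT) (Var NT));
    (NT, Clos (Var NT) (Var NS));
    (NS, Slash (Var NT)); (NS, Lift (Var NS)); (NS, Shift);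
    (NN, Zero); (NN, Succ (Var NN)) ].

Definition nt_of (n : nat) (X : nt) : Prop :=
  match X with NG k => k <= n | _ => True end.

Definition upsilon_RG (n : nat) (P : productions) : Prop :=
  (forall X alpha, In (X, alpha) P ->
      nt_of n X /\ forall Y, occurs Y alpha -> nt_of n Y) /\
  (forall p, In p Lambda_prods -> In p P) /\
  (forall k, k <= n ->
      unambiguous P (NG k) /\
      forall t, lang P (Var (NG k)) t <-> normalises_in k t).

Definition simple_RG (n : nat) (P : productions) : Prop :=
  upsilon_RG n P /\
  (forall X alpha, In (X, alpha) P -> occurs X alpha ->
      In (X, alpha) Lambda_prods \/
      exists k, X = NG k /\
        (alpha = Lam (Var (NG k)) \/
         alpha = App (Var (NG 0)) (Var (NG k)) \/
         alpha = App (Var (NG k)) (Var (NG 0)))) /\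
  (forall k alpha, In (NG k, alpha) P -> ~ occurs (NG k) alpha ->
      forall Y, occurs Y alpha ->
        Y = NT \/ Y = NS \/ Y = NN \/ exists j, j < k /\ Y = NG j).

(* Main.v *)
Require Import Defs.
From Stdlib Require Import List Arith Lia Wellfounded Program.Equality Eqdep_dec Bool.
Import ListNotations.

(** Normal-order υ-reduction is captured by a syntax-directed cost relation
    [cost t σ c] that pushes a stack [σ] of pending substitutions through [t]:
    an index costs nothing, an application or an abstraction costs the sum of
    its parts plus one step per pending substitution, and a term normalises in
    [k] steps iff its cost is [k].  This gives [G_k -> λG_k | G_i G_(k-i)] and
    [G_0 -> N] directly.  For a closure [a[s]] the cost relation is run
    symbolically on the pattern [T[S]] with budget [k]: whenever it inspects a
    non-terminal, that hole is refined into the disjoint right-hand sides of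
    its productions, and a [T] under the empty stack is closed by some [G_j],
    paying [j].  Every step spends budget or shrinks the pending work, so only
    finitely many final patterns arise; they are exactly the closure
    productions of [G_k], they mention [G_j] only for [j < k] (something is
    paid before the first stack empties), and their disjointness makes the
    grammar unambiguous. *)

(* [gtm] is a definition: [@length gtm l] and [@length (tm novar) l] are
   different atoms for [lia] until it is unfolded. *)
Ltac glia := unfold gtm in *; lia.

#[local] Hint Constructors is_index : core.

(** * A cost semantics of normal-order reduction *)

(** [cost t σ c]: the closure [t[σ_1]...[σ_m]] ([σ_1] innermost) reaches its
    normal form in [c] normal-order steps. *)
Inductive cost : gtm -> list gtm -> nat -> Prop :=
| cost_clos a s σ c : cost a (s :: σ) c -> cost (Clos a s) σ c
| cost_app u v σ c1 c2 :
    cost u σ c1 -> cost v σ c2 -> cost (App u v) σ (length σ + c1 + c2)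
| cost_lam u σ c : cost u (map Lift σ) c -> cost (Lam u) σ (length σ + c)
| cost_zero : cost Zero [] 0
| cost_succ n : cost (Succ n) [] 0
| cost_zero_slash b σ c : cost b σ c -> cost Zero (Slash b :: σ) (S c)
| cost_succ_slash n b σ c : cost n σ c -> cost (Succ n) (Slash b :: σ) (S c)
| cost_zero_lift s σ c : cost Zero σ c -> cost Zero (Lift s :: σ) (S c)
| cost_succ_lift n s σ c :
    cost n (s :: Shift :: σ) c -> cost (Succ n) (Lift s :: σ) (S c)
| cost_zero_shift σ c : cost (Succ Zero) σ c -> cost Zero (Shift :: σ) (S c)
| cost_succ_shift n σ c :
    cost (Succ (Succ n)) σ c -> cost (Succ n) (Shift :: σ) (S c).

Lemma cost_functional t σ c1 c2 : cost t σ c1 -> cost t σ c2 -> c1 = c2.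
Proof.
  intros H; revert c2; induction H; intros d Hd; inversion Hd; subst; f_equal; auto.
Qed.

Lemma cost_ge_length t σ c : cost t σ c -> length σ <= c.
Proof. induction 1; cbn in *; rewrite ?length_map in *; glia. Qed.

Lemma cost_clos_iff a s σ c : cost (Clos a s) σ c <-> cost a (s :: σ) c.
Proof. split; intro H; [inversion H; subst; auto | constructor; auto]. Qed.

Lemma cost_app_iff u v σ c : cost (App u v) σ c <->
  exists c1 c2, c = length σ + c1 + c2 /\ cost u σ c1 /\ cost v σ c2.
Proof.
  split; intro H.
  - inversion H; subst; eauto.
  - destruct H as (c1 & c2 & -> & H1 & H2); constructor; auto.
Qed.

Lemma cost_lam_iff u σ c : cost (Lam u) σ c <->
  exists c', c = length σ + c' /\ cost u (map Lift σ) c'.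
Proof.
  split; intro H.
  - inversion H; subst; eauto.
  - destruct H as (c' & -> & H1); constructor; auto.
Qed.

Lemma cost_index t : is_index t -> cost t [] 0.
Proof. destruct 1; constructor. Qed.

Lemma cost_root_step x x' σ c : root_step x x' -> cost x' σ c -> cost x σ (S c).
Proof.
  intros Hx Hc; destruct Hx.
  - apply cost_app_iff in Hc as (c1 & c2 & -> & H1 & H2).
    apply cost_clos_iff in H1, H2.
    constructor. replace (S _) with (length (s :: σ) + c1 + c2) by (cbn; glia).
    constructor; auto.
  - apply cost_lam_iff in Hc as (c' & -> & H1). apply cost_clos_iff in H1.
    constructor. replace (S _) with (length (s :: σ) + c') by (cbn; glia).
    constructor; auto.
  - do 2 constructor; auto.
  - do 2 constructor; auto.
  - do 2 constructor; auto.
  - rewrite !cost_clos_iff in Hc. do 2 constructor; auto.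
  - constructor. destruct H; constructor; auto.
Qed.

Lemma is_term_inv t : is_term t ->
  match t with
  | App a b => is_term a /\ is_term b
  | Clos a s => is_term a /\ is_subst s
  | Lam a => is_term a
  | Succ n => is_index n
  | Zero => True
  | _ => False
  end.
Proof. intro H; inversion H; subst; auto; inversion H0; subst; auto. Qed.

Lemma is_subst_inv s : is_subst s ->
  match s with
  | Slash a => is_term a
  | Lift s => is_subst s
  | Shift => True
  | _ => False
  end.
Proof. intro H; inversion H; subst; auto. Qed.

Lemma index_normal n : is_index n -> normal n.
Proof.
  induction 1; intros u Hs; inversion Hs; subst.
  - inversion H.
  - inversion H0.
  - eapply IHis_index; eauto.
Qed.

Lemma nstep_step t u : nstep t u -> step t u.
Proof.
  induction 1; [apply st_root | apply st_app_l | apply st_app_r | apply st_clos_l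
  | apply st_clos_r | apply st_lam | apply st_slash | apply st_lift | apply st_succ];
  auto.
Qed.

Lemma clos_not_normal a s : is_term a -> is_subst s -> ~ normal (Clos a s).
Proof.
  revert s; induction a; intros s Ha Hs Hn; apply is_term_inv in Ha;
    try contradiction.
  - eapply Hn, st_root, r_app.
  - destruct Ha as [Ha1 Ha2]. apply (IHa1 a2 Ha1 Ha2).
    intros u Hu. eapply Hn, st_clos_l; eauto.
  - eapply Hn, st_root, r_lam.
  - apply is_subst_inv in Hs.
    destruct s; try contradiction; eapply Hn, st_root; constructor; auto.
  - apply is_subst_inv in Hs.
    destruct s; try contradiction; eapply Hn, st_root; constructor; auto.
Qed.

Lemma clos_not_redex a s : is_term a -> is_subst s -> ~ is_redex (Clos a s) ->
  exists a0 s0, a = Clos a0 s0.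
Proof.
  intros Ha Hs Hr. apply is_term_inv in Ha. apply is_subst_inv in Hs.
  destruct a; try contradiction; eauto; exfalso; apply Hr;
    destruct s; try contradiction; eexists;
    first [constructor; auto; fail | constructor; constructor; auto].
Qed.

Lemma root_step_term x x' : root_step x x' -> is_term x -> is_term x'.
Proof.
  intros H Hx; destruct H; apply is_term_inv in Hx as [Ha Hs];
    apply is_term_inv in Ha; cbn in Ha.
  - apply tm_app; apply tm_clos; tauto.
  - apply tm_lam, tm_clos; auto using sb_lift.
  - apply is_subst_inv in Hs; auto.
  - apply tm_idx; auto.
  - apply tm_idx; constructor.
  - apply is_subst_inv in Hs.
    apply tm_clos; [apply tm_clos; [apply tm_idx|] |]; auto using sb_shift.
  - apply tm_idx; constructor; auto.
Qed.

Lemma nstep_sorts t u : nstep t u ->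
  (is_term t -> is_term u) /\ (is_subst t -> is_subst u).
Proof.
  induction 1 as [t u H| | | |a s s' Hr Hn| | | |a a' Hr H IH]; split; intro Ht;
    [ eapply root_step_term; eauto | destruct H; inversion Ht
    | first [apply is_term_inv in Ht | apply is_subst_inv in Ht]; cbn in Ht;
      try contradiction .. ].
  - apply tm_app; tauto.
  - apply tm_app; tauto.
  - apply tm_clos; tauto.
  - destruct Ht as [Ha Hs].
    destruct (clos_not_redex a s Ha Hs Hr) as (a0 & s0 & ->).
    apply is_term_inv in Ha as [Ha0 Hs0].
    exfalso; exact (clos_not_normal a0 s0 Ha0 Hs0 Hn).
  - apply tm_lam; tauto.
  - apply sb_slash; tauto.
  - apply sb_lift; tauto.
  - exfalso. eapply index_normal; eauto using nstep_step.
Qed.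

Lemma nstep_term t u : nstep t u -> is_term t -> is_term u.
Proof. intros H; apply (nstep_sorts _ _ H). Qed.

Lemma normal_cost u : is_term u -> normal u -> cost u [] 0.
Proof.
  induction u; intros Ht Hn; apply is_term_inv in Ht; cbn in Ht; try contradiction.
  - apply (cost_app _ _ [] 0 0); [apply IHu1 | apply IHu2]; try tauto;
      intros w Hw; eapply Hn; [apply st_app_l | apply st_app_r]; eauto.
  - exfalso; destruct Ht; exact (clos_not_normal _ _ H H0 Hn).
  - apply (cost_lam _ [] 0), IHu; auto.
    intros w Hw; eapply Hn, st_lam; eauto.
  - constructor.
  - constructor.
Qed.

Lemma cost_zero_normal t : cost t [] 0 -> is_term t -> normal t.
Proof.
  remember [] as σ eqn:Eσ; remember 0 as c eqn:Ec.
  induction 1; intros Ht; subst; cbn in *; try discriminate.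
  - apply cost_ge_length in H; cbn in H; lia.
  - apply is_term_inv in Ht as [Ht1 Ht2].
    intros w Hw; inversion Hw; subst.
    + inversion H1.
    + eapply IHcost1; eauto; lia.
    + eapply IHcost2; eauto; lia.
  - apply is_term_inv in Ht. intros w Hw; inversion Hw; subst.
    + inversion H0.
    + eapply IHcost; eauto.
  - apply index_normal; auto.
  - apply is_term_inv in Ht. apply index_normal; auto.
Qed.

Lemma cost_nstep_clos a s u τ c : is_term (Clos a s) -> nstep (Clos a s) u ->
  cost u τ c -> cost (Clos a s) τ (S c).
Proof.
  revert s u τ c; induction a; intros s u τ c Ht Hst Hc;
    apply is_term_inv in Ht as [Ha Hs]; inversion Hst; subst;
    try (eapply cost_root_step; eauto; fail);
    destruct (clos_not_redex _ _ Ha Hs H1) as (a0 & s0 & E); try discriminate;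
    injection E as <- <-.
  - apply cost_clos_iff, IHa1 with a'; auto. apply cost_clos_iff; auto.
  - apply is_term_inv in Ha as [Ha Hs0]. exfalso; exact (clos_not_normal _ _ Ha Hs0 H2).
Qed.

Lemma cost_nstep t t' c : nstep t t' -> is_term t -> cost t' [] c -> cost t [] (S c).
Proof.
  intros Hst; revert c.
  induction Hst as [t t' H|a a' b Hr H IH|a b b' Hr Hn H IH|a a' s Hr H IH
                   |a s s' Hr Hn H IH|a a' Hr H IH| | |a a' Hr H IH];
    intros c Ht Hc; apply is_term_inv in Ht as Ht'; cbn in Ht'; try contradiction.
  - eapply cost_root_step; eauto.
  - apply cost_app_iff in Hc as (c1 & c2 & -> & H1 & H2).
    apply (cost_app _ _ [] (S c1) c2); [apply IH|]; tauto.
  - apply cost_app_iff in Hc as (c1 & c2 & -> & H1 & H2).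
    assert (c1 = 0) as -> by (eapply cost_functional; [exact H1 | apply normal_cost;
      tauto]).
    apply (cost_app _ _ [] 0 (S c2)); [|apply IH]; tauto.
  - eapply cost_nstep_clos; eauto. apply ns_clos_l; auto.
  - destruct Ht' as [Ha Hs].
    destruct (clos_not_redex _ _ Ha Hs Hr) as (a0 & s0 & ->).
    apply is_term_inv in Ha as [Ha Hs0]. exfalso; exact (clos_not_normal _ _ Ha Hs0 Hn).
  - apply cost_lam_iff in Hc as (c' & -> & H1). apply (cost_lam _ [] (S c')); auto.
  - exfalso. eapply index_normal; eauto using nstep_step.
Qed.

Lemma clos_clos_not_redex a s s' : ~ is_redex (Clos (Clos a s) s').
Proof.
  intros [v Hv]; inversion Hv; subst;
    match goal with H : is_index _ |- _ => inversion H end.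
Qed.

Lemma cost_S_nstep_clos a s τ c : is_term (Clos a s) -> cost (Clos a s) τ (S c) ->
  exists u, nstep (Clos a s) u /\ cost u τ c.
Proof.
  revert s τ c; induction a; intros s τ c Ht Hc; rewrite cost_clos_iff in Hc;
    apply is_term_inv in Ht as [Ha Hs]; apply is_term_inv in Ha; cbn in Ha;
    try contradiction.
  - apply cost_app_iff in Hc as (c1 & c2 & E & H1 & H2).
    exists (App (Clos a1 s) (Clos a2 s)). split; [apply ns_root; constructor|].
    cbn in E. replace c with (length τ + c1 + c2) by glia.
    constructor; constructor; auto.
  - destruct (IHa1 a2 (s :: τ) c) as (u & H1 & H2); [apply tm_clos; tauto | auto |].
    exists (Clos u s). split; [apply ns_clos_l; auto using clos_clos_not_redex|].
    constructor; auto.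
  - apply cost_lam_iff in Hc as (c' & E & H1).
    exists (Lam (Clos a (Lift s))). split; [apply ns_root; constructor|].
    cbn in E. replace c with (length τ + c') by glia. do 2 constructor. auto.
  - apply is_subst_inv in Hs.
    destruct s; try contradiction; inversion Hc; subst;
      (eexists; split; [apply ns_root; econstructor; eauto | eauto]).
    do 2 constructor; auto.
  - apply is_subst_inv in Hs.
    destruct s; try contradiction; inversion Hc; subst;
      (eexists; split; [apply ns_root; econstructor; eauto | eauto]).
Qed.

Lemma cost_S_nstep t c : is_term t -> cost t [] (S c) ->
  exists t', nstep t t' /\ cost t' [] c.
Proof.
  revert c; induction t; intros c Ht Hc; apply is_term_inv in Ht as Ht';
    cbn in Ht'; try contradiction.
  - apply cost_app_iff in Hc as (c1 & c2 & E & H1 & H2). cbn in E.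
    destruct c1 as [|c1].
    + destruct (IHt2 c) as (t' & Hs & Hc'); [tauto | replace (S c) with c2 by lia; auto|].
      exists (App t1 t'); split.
      * apply ns_app_r; [intros [u Hu]; inversion Hu | | auto].
        apply cost_zero_normal; tauto.
      * apply (cost_app _ _ [] 0 c); auto.
    + destruct (IHt1 c1) as (t' & Hs & Hc'); [tauto | auto |].
      exists (App t' t2); split.
      * apply ns_app_l; auto. intros [u Hu]; inversion Hu.
      * replace c with (length (@nil gtm) + c1 + c2) by (cbn; lia). constructor; auto.
  - apply cost_S_nstep_clos; auto.
  - apply cost_lam_iff in Hc as (c' & E & H1). cbn in E; subst.
    destruct (IHt c) as (t' & Hs & Hc'); auto.
    exists (Lam t'); split.
    + apply ns_lam; auto. intros [u Hu]; inversion Hu.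
    + apply (cost_lam _ [] c); auto.
  - inversion Hc.
  - inversion Hc.
Qed.

Theorem normalises_in_iff_cost k t : normalises_in k t <-> is_term t /\ cost t [] k.
Proof.
  split.
  - intros [Ht (u & Hs & Hn)]. split; auto. revert Ht. induction Hs; intro Ht.
    + apply normal_cost; auto.
    + eapply cost_nstep; eauto using nstep_term.
  - intros [Ht Hc]. split; auto. revert t Ht Hc. induction k; intros t Ht Hc.
    + exists t; split; [constructor | apply cost_zero_normal; auto].
    + destruct (cost_S_nstep t k Ht Hc) as (t' & Hs & Hc').
      destruct (IHk t' (nstep_term _ _ Hs Ht) Hc') as (u & H1 & H2).
      exists u; split; auto. econstructor; eauto.
Qed.

(** * Patterns *)

(** Patterns are sentential forms [tm nt].  The symbolic machine below
    refines a pattern by grafting at positions given by paths (child [0] is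
    the first argument, child [1] the second), and it works on path-terms
    [tm path] whose variables point into the pattern being refined. *)
Definition path := list nat.

Definition child {X} (t : tm X) (i : nat) : option (tm X) :=
  match t, i with
  | App a _, 0 | Clos a _, 0 | Lam a, 0 | Slash a, 0 | Lift a, 0 | Succ a, 0 => Some a
  | App _ b, 1 | Clos _ b, 1 => Some b
  | _, _ => None
  end.

Fixpoint subterm {X} (t : tm X) (p : path) : option (tm X) :=
  match p with
  | [] => Some t
  | i :: p' => match child t i with Some c => subterm c p' | None => None end
  end.

Definition set_child {X} (t : tm X) (i : nat) (c : tm X) : tm X :=
  match t, i with
  | App _ b, 0 => App c b | App a _, 1 => App a c
  | Clos _ b, 0 => Clos c b | Clos a _, 1 => Clos a c
  | Lam _, 0 => Lam c | Slash _, 0 => Slash c | Lift _, 0 => Lift c | Succ _, 0 => Succ c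
  | _, _ => t
  end.

Fixpoint graft {X} (t : tm X) (p : path) (q : tm X) : tm X :=
  match p with
  | [] => q
  | i :: p' => match child t i with Some c => set_child t i (graft c p' q) | None => t end
  end.

Lemma child_set_child {X} (t : tm X) i c c' :
  child t i = Some c -> child (set_child t i c') i = Some c'.
Proof. destruct t; destruct i as [|[|i]]; simpl; congruence. Qed.

Lemma child_set_child_other {X} (t : tm X) i j c' :
  i <> j -> child (set_child t i c') j = child t j.
Proof.
  intros H; destruct t; destruct i as [|[|i]]; destruct j as [|[|j]]; simpl; auto;
    congruence.
Qed.

Lemma subterm_app {X} (t : tm X) p q :
  subterm t (p ++ q) = match subterm t p with Some t' => subterm t' q | None => None end.
Proof.
  revert t; induction p as [|i p IH]; intros t; simpl; auto.
  destruct (child t i); auto.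
Qed.

Lemma subterm_graft {X} (R : tm X) p u q :
  subterm R p = Some u -> subterm (graft R p q) p = Some q.
Proof.
  revert R; induction p as [|i p IH]; intros R H; simpl in *; auto.
  destruct (child R i) eqn:E; try discriminate.
  erewrite child_set_child; eauto.
Qed.

Lemma graft_defined {X} (R : tm X) p p' Y q : subterm R p = Some (Var Y) ->
  subterm R p' <> None -> subterm (graft R p q) p' <> None.
Proof.
  revert R p; induction p' as [|i p' IH]; intros R p H1 H2; simpl in *; try congruence.
  destruct (child R i) eqn:E; try congruence.
  destruct p as [|j p]; simpl in H1.
  - injection H1 as ->. discriminate.
  - destruct (child R j) eqn:E2; try discriminate.
    destruct (Nat.eq_dec j i) as [->|Hne].
    + rewrite E in E2; injection E2 as ->.
      simpl. rewrite E. erewrite child_set_child; eauto.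
    + simpl. rewrite E2, child_set_child_other, E; auto.
Qed.

Fixpoint tsize {X} (t : tm X) : nat :=
  match t with
  | Var _ | Shift | Zero => 1
  | App a b | Clos a b => 1 + tsize a + tsize b
  | Lam a | Slash a | Lift a | Succ a => 1 + tsize a
  end.

Lemma tsize_set_child {X} (t : tm X) i c c' : child t i = Some c ->
  tsize c' = tsize c -> tsize (set_child t i c') = tsize t.
Proof.
  destruct t; destruct i as [|[|i]]; simpl; intros H1 H2; try injection H1 as <-;
    lia || congruence.
Qed.

Lemma tsize_graft_var {X} (R : tm X) p Y Z :
  subterm R p = Some (Var Y) -> tsize (graft R p (Var Z)) = tsize R.
Proof.
  revert R; induction p as [|i p IH]; intros R H; simpl in *.
  - injection H as ->; reflexivity.
  - destruct (child R i) eqn:E; try discriminate.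
    eapply tsize_set_child; eauto.
Qed.

Lemma subterm_graft_var_size {X} (R : tm X) p p' Y Z : subterm R p = Some (Var Y) ->
  option_map tsize (subterm (graft R p (Var Z)) p') = option_map tsize (subterm R p').
Proof.
  revert R p; induction p' as [|i p' IH]; intros R p H; simpl in *.
  - f_equal. eapply tsize_graft_var; eauto.
  - destruct p as [|j p]; simpl in H.
    + injection H as ->. reflexivity.
    + destruct (child R j) eqn:E; try discriminate.
      destruct (Nat.eq_dec j i) as [->|Hne]; simpl; rewrite E.
      * erewrite child_set_child; eauto.
      * rewrite child_set_child_other; auto.
Qed.

Definition nt_lang (X : nt) (t : gtm) : Prop :=
  match X with
  | NT => is_term t
  | NS => is_subst t
  | NN => is_index t
  | NG j => is_term t /\ cost t [] j
  end.

Fixpoint matches (b : tm nt) (t : gtm) : Prop :=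
  match b, t with
  | Var X, _ => nt_lang X t
  | App a b, App u v => matches a u /\ matches b v
  | Clos a b, Clos u v => matches a u /\ matches b v
  | Lam a, Lam u => matches a u
  | Slash a, Slash u => matches a u
  | Lift a, Lift u => matches a u
  | Succ a, Succ u => matches a u
  | Shift, Shift => True
  | Zero, Zero => True
  | _, _ => False
  end.

Lemma matches_child R g i c : matches R g -> child R i = Some c ->
  exists gi, child g i = Some gi /\ matches c gi.
Proof.
  intros H1 H2; destruct R; destruct g; simpl in *; try contradiction;
    destruct i as [|[|i]]; simpl in *; try discriminate; injection H2 as <-;
    eexists; split; eauto; tauto.
Qed.

Lemma matches_set_child_inv R g i c c' : child R i = Some c ->
  (forall gi, matches c' gi -> matches c gi) -> matches (set_child R i c') g -> matches R g.
Proof.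
  intros H1 H2 H3; destruct R; destruct g; destruct i as [|[|i]]; simpl in *;
    try discriminate; try injection H1 as <-; intuition.
Qed.

Lemma matches_set_child R g i c c' gi : child R i = Some c ->
  matches R g -> child g i = Some gi -> matches c' gi -> matches (set_child R i c') g.
Proof.
  intros H1 H2 H3 H4; destruct R; destruct g; destruct i as [|[|i]]; simpl in *;
    try discriminate; try contradiction; try injection H3 as <-; intuition.
Qed.

Lemma matches_subterm R g p u : matches R g -> subterm R p = Some u ->
  exists g', subterm g p = Some g' /\ matches u g'.
Proof.
  revert R g; induction p as [|i p IH]; intros R g H1 H2; simpl in *.
  - injection H2 as <-. eauto.
  - destruct (child R i) eqn:E; try discriminate.
    destruct (matches_child _ _ _ _ H1 E) as (gi & E' & H3). rewrite E'. eauto.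
Qed.

Lemma matches_graft_inv R p X q g : subterm R p = Some (Var X) ->
  (forall t, matches q t -> nt_lang X t) -> matches (graft R p q) g -> matches R g.
Proof.
  revert R g; induction p as [|i p IH]; intros R g H1 H2 H3; simpl in *.
  - injection H1 as ->. simpl. auto.
  - destruct (child R i) eqn:E; try discriminate.
    eapply matches_set_child_inv; [exact E | | exact H3].
    intros gi Hgi. eapply IH; eauto.
Qed.

Lemma matches_graft_subterm R p X q g : subterm R p = Some (Var X) ->
  matches (graft R p q) g -> exists g', subterm g p = Some g' /\ matches q g'.
Proof. intros. eapply matches_subterm; eauto. eapply subterm_graft; eauto. Qed.

Lemma matches_graft R p X q g g' : subterm R p = Some (Var X) ->
  matches R g -> subterm g p = Some g' -> matches q g' -> matches (graft R p q) g.
Proof.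
  revert R g; induction p as [|i p IH]; intros R g H1 H2 H3 H4; simpl in *.
  - injection H3 as <-. auto.
  - destruct (child R i) eqn:E; try discriminate.
    destruct (matches_child _ _ _ _ H2 E) as (gi & E' & H5). rewrite E' in H3.
    eapply matches_set_child; eauto.
Qed.

(** [Zero] is a junk value for undefined positions. *)
Definition gsubterm (g : gtm) (p : path) : gtm :=
  match subterm g p with Some u => u | None => Zero end.

Lemma gsubterm_eq g p g' : subterm g p = Some g' -> gsubterm g p = g'.
Proof. intro E; unfold gsubterm; rewrite E; auto. Qed.

Fixpoint inst (g : gtm) (t : tm path) : gtm :=
  match t with
  | Var p => gsubterm g p
  | App a b => App (inst g a) (inst g b)
  | Clos a b => Clos (inst g a) (inst g b)
  | Lam a => Lam (inst g a)
  | Slash a => Slash (inst g a)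
  | Lift a => Lift (inst g a)
  | Succ a => Succ (inst g a)
  | Shift => Shift
  | Zero => Zero
  end.

Definition expose (p : path) (u : tm nt) : tm path :=
  match u with
  | App _ _ => App (Var (p ++ [0])) (Var (p ++ [1]))
  | Clos _ _ => Clos (Var (p ++ [0])) (Var (p ++ [1]))
  | Lam _ => Lam (Var (p ++ [0]))
  | Slash _ => Slash (Var (p ++ [0]))
  | Lift _ => Lift (Var (p ++ [0]))
  | Succ _ => Succ (Var (p ++ [0]))
  | Shift => Shift
  | Zero => Zero
  | Var _ => Var p
  end.

Lemma inst_expose R g p u : matches R g -> subterm R p = Some u ->
  inst g (expose p u) = gsubterm g p.
Proof.
  intros H1 H2.
  destruct (matches_subterm _ _ _ _ H1 H2) as (g' & E & H3).
  destruct u; destruct g'; simpl in H3; try contradiction; simpl;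
    unfold gsubterm; rewrite ?subterm_app, E; reflexivity.
Qed.

Definition notvar {X} (t : tm X) : Prop := match t with Var _ => False | _ => True end.

Lemma notvar_expose p q : notvar q -> notvar (expose p q).
Proof. destruct q; simpl; auto. Qed.

Fixpoint all_vars {X} (P : X -> Prop) (t : tm X) : Prop :=
  match t with
  | Var x => P x
  | App a b | Clos a b => all_vars P a /\ all_vars P b
  | Lam a | Slash a | Lift a | Succ a => all_vars P a
  | Shift | Zero => True
  end.

Lemma all_vars_impl {X} (P Q : X -> Prop) t :
  (forall x, P x -> Q x) -> all_vars P t -> all_vars Q t.
Proof. intros H; induction t; simpl; intuition. Qed.

Lemma all_vars_graft {X} (P : X -> Prop) R p q :
  all_vars P R -> all_vars P q -> all_vars P (graft R p q).
Proof.
  revert R; induction p as [|i p IH]; intros R H1 H2; simpl; auto.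
  destruct (child R i) eqn:E; auto.
  destruct R; destruct i as [|[|i]]; simpl in *; try discriminate; injection E as <-;
    intuition.
Qed.

Lemma all_vars_subterm {X} (P : X -> Prop) R p u :
  all_vars P R -> subterm R p = Some u -> all_vars P u.
Proof.
  revert R; induction p as [|i p IH]; intros R H1 H2; simpl in *.
  - injection H2 as <-; auto.
  - destruct (child R i) eqn:E; try discriminate.
    apply (IH t); auto.
    destruct R; destruct i as [|[|i]]; simpl in *; try discriminate; injection E as <-;
      intuition.
Qed.

Lemma occurs_all_vars (P : nt -> Prop) α Y : all_vars P α -> occurs Y α -> P Y.
Proof. induction α; simpl; intros; try subst; intuition eauto. Qed.

Definition defined_at (R : tm nt) (p : path) : Prop := subterm R p <> None.

Lemma all_vars_expose R p u : subterm R p = Some u -> all_vars (defined_at R) (expose p u).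
Proof.
  intros H; unfold defined_at; destruct u; simpl; repeat split;
    rewrite ?subterm_app, H; simpl; congruence.
Qed.

Lemma defined_at_graft R p X q : subterm R p = Some (Var X) ->
  forall p', defined_at R p' -> defined_at (graft R p q) p'.
Proof. intros H p' H'. eapply graft_defined; eauto. Qed.

Lemma notvar_graft (R : tm nt) p X q :
  notvar R -> subterm R p = Some (Var X) -> notvar (graft R p q).
Proof.
  intros H1 H2. destruct p as [|i p]; simpl in *.
  - injection H2 as ->. contradiction.
  - destruct (child R i); auto. destruct R; destruct i as [|[|i]]; simpl in *; auto.
Qed.

(** How the head of a path-term looks inside the pattern [R]: a hole
    (non-terminal) of [R], a constructor, or a dangling path. *)
Inductive head_class := CHole (p : path) (X : nt) | CCon (a : tm path) | CBad.

Definition classify (R : tm nt) (t : tm path) : head_class :=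
  match t with
  | Var p => match subterm R p with
             | Some (Var X) => CHole p X
             | Some u => CCon (expose p u)
             | None => CBad
             end
  | _ => CCon t
  end.

Lemma classify_con R t a : classify R t = CCon a ->
  (forall g, matches R g -> inst g a = inst g t) /\ notvar a /\
  (all_vars (defined_at R) t -> all_vars (defined_at R) a).
Proof.
  intros H. destruct t; simpl in H;
    try (injection H as <-; split; [reflexivity | split; [exact I | auto]]).
  destruct (subterm R p) eqn:E; [|discriminate].
  destruct t; try discriminate; injection H as <-; (split; [|split]);
    try (intros g Hg; exact (inst_expose R g p _ Hg E));
    try (intros _; exact (all_vars_expose R p _ E)); exact I.
Qed.

Lemma classify_hole R t p X : classify R t = CHole p X ->
  t = Var p /\ subterm R p = Some (Var X).
Proof.
  intros H; destruct t; simpl in H; try discriminate.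
  destruct (subterm R p0) eqn:E; try discriminate. destruct t; try discriminate.
  injection H as <- <-. auto.
Qed.

Lemma classify_bad R t : classify R t = CBad -> ~ all_vars (defined_at R) t.
Proof.
  intros H; destruct t; simpl in H; try discriminate.
  destruct (subterm R p) eqn:E; try (destruct t; discriminate). simpl. unfold defined_at.
    auto.
Qed.

(** * A symbolic cost machine *)

(** A job [(a, σ)] asks for the cost of the closure of the path-term [a] under
    the substitution stack [σ], as in [cost].  A state holds the pattern [pat]
    being refined, a stack of pending jobs and the cost [budget] still to be
    spent. *)
Definition job := (tm path * list (tm path))%type.

Record state := mkstate { pat : tm nt; jobs : list job; budget : nat }.

Definition charge (c : nat) (R : tm nt) (J : list job) (b : nat) : list state :=
  if c <=? b then [mkstate R J (b - c)] else [].

Definition index_rule (R : tm nt) (a s : tm path) (rest : list (tm path))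
  (J : list job) (b : nat) : list state :=
  match a, s with
  | Zero, Slash x => charge 1 R ((x, rest) :: J) b
  | Succ n, Slash _ => charge 1 R ((n, rest) :: J) b
  | Zero, Lift _ => charge 1 R ((Zero, rest) :: J) b
  | Succ n, Lift s' => charge 1 R ((n, s' :: Shift :: rest) :: J) b
  | Zero, Shift => charge 1 R ((Succ Zero, rest) :: J) b
  | Succ n, Shift => charge 1 R ((Succ (Succ n), rest) :: J) b
  | _, _ => []
  end.

Definition cases_S : list (tm nt) := [Slash (Var NT); Lift (Var NS); Shift].
Definition cases_N : list (tm nt) := [Zero; Succ (Var NN)].
Definition cases_T : list (tm nt) :=
  [Zero; Succ (Var NN); Lam (Var NT); App (Var NT) (Var NT); Clos (Var NT) (Var NS)].
Definition expand_N (b : tm nt) : list (tm nt) :=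
  match b with Var NN => cases_N | Var _ => [] | _ => [b] end.

(** [pr j] are the right-hand sides of the productions of [G_j]. *)
Definition cases_G (pr : nat -> list (tm nt)) (j : nat) : list (tm nt) :=
  flat_map expand_N (pr j).

Definition index_step (R : tm nt) (a : tm path) (σ : list (tm path))
  (J : list job) (b : nat) : list state :=
  match σ with
  | [] => [mkstate R J b]
  | s :: rest =>
      match classify R s with
      | CHole p NS =>
          flat_map (fun q => index_rule (graft R p q) a (expose p q) rest J b) cases_S
      | CCon s' => index_rule R a s' rest J b
      | _ => []
      end
  end.

Definition node_step (R : tm nt) (a : tm path) (σ : list (tm path))
  (J : list job) (b : nat) : list state :=
  match a with
  | Clos x s => [mkstate R ((x, s :: σ) :: J) b]
  | App u v => charge (length σ) R ((u, σ) :: (v, σ) :: J) b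
  | Lam u => charge (length σ) R ((u, map Lift σ) :: J) b
  | Zero | Succ _ => index_step R a σ J b
  | _ => []
  end.

Definition hole_cases (pr : nat -> list (tm nt)) (X : nt) : list (tm nt) :=
  match X with NT => cases_T | NN => cases_N | NG j => cases_G pr j | NS => [] end.

(** A [T]-hole under the empty stack is closed by [G_j], for each cost [j]
    the budget allows. *)
Definition hole_step (pr : nat -> list (tm nt)) (R : tm nt) (p : path) (X : nt)
  (σ : list (tm path)) (J : list job) (b : nat) : list state :=
  match σ with
  | [] => match X with
          | NT => map (fun j => mkstate (graft R p (Var (NG j))) J (b - j)) (seq 0 (S b))
          | NG j => charge j R J b
          | NN => [mkstate R J b]
          | NS => []
          end
  | _ => flat_map (fun q => node_step (graft R p q) (expose p q) σ J b) (hole_cases pr X)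
  end.

Definition mstep (pr : nat -> list (tm nt)) (S : state) : list state :=
  match jobs S with
  | [] => []
  | (a, σ) :: J =>
      match classify (pat S) a with
      | CHole p X => hole_step pr (pat S) p X σ J (budget S)
      | CCon a' => node_step (pat S) a' σ J (budget S)
      | CBad => []
      end
  end.

(** Every pending substitution costs at least one step. *)
Definition stack_load (J : list job) : nat :=
  fold_right (fun jb acc => length (snd jb) + acc) 0 J.

Definition mstep_pruned (pr : nat -> list (tm nt)) (S : state) : list state :=
  filter (fun S' => stack_load (jobs S') <=? budget S') (mstep pr S).

Fixpoint psize (R : tm nt) (t : tm path) : nat :=
  match t with
  | Var p => match subterm R p with Some u => tsize u | None => 1 end
  | App a b | Clos a b => 1 + psize R a + psize R b
  | Lam a | Slash a | Lift a | Succ a => 1 + psize R a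
  | Shift | Zero => 1
  end.

Definition jobs_size (R : tm nt) (J : list job) : nat :=
  fold_right (fun jb acc => psize R (fst jb) + acc) 0 J.

Definition lex3 (x y : nat * nat * nat) : Prop :=
  let '(x1, x2, x3) := x in let '(y1, y2, y3) := y in
  x1 < y1 \/ (x1 = y1 /\ (x2 < y2 \/ (x2 = y2 /\ x3 < y3))).

Lemma lex3_wf : well_founded lex3.
Proof.
  intros [[a b] c]. revert b c.
  induction a as [a IHa] using (well_founded_induction lt_wf).
  intro b. induction b as [b IHb] using (well_founded_induction lt_wf).
  intro c. induction c as [c IHc] using (well_founded_induction lt_wf).
  constructor. intros [[a' b'] c'] H. simpl in H.
  destruct H as [H|[-> [H|[-> H]]]]; auto.
Qed.

Definition rank (S : state) : nat * nat * nat :=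
  (budget S, budget S - stack_load (jobs S), jobs_size (pat S) (jobs S)).

Lemma psize_classify R t a : classify R t = CCon a -> psize R a = psize R t.
Proof.
  destruct t; simpl; intro H; try (injection H as <-; reflexivity).
  destruct (subterm R p) eqn:E; try discriminate.
  destruct t; try discriminate; injection H as <-; simpl; rewrite ?subterm_app, ?E;
    simpl; lia.
Qed.

Lemma psize_graft_var R p Y Z t : subterm R p = Some (Var Y) ->
  psize (graft R p (Var Z)) t = psize R t.
Proof.
  intros H; induction t as [q| | | | | | | |]; simpl; auto.
  pose proof (subterm_graft_var_size R p q Y Z H) as E.
  destruct (subterm (graft R p (Var Z)) q), (subterm R q); simpl in E;
    try discriminate; auto.
  injection E; auto.
Qed.

Lemma jobs_size_graft_var R p Y Z J : subterm R p = Some (Var Y) ->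
  jobs_size (graft R p (Var Z)) J = jobs_size R J.
Proof.
  intros H; induction J; simpl; auto. rewrite IHJ, (psize_graft_var R p Y Z); auto.
Qed.

Lemma in_charge c R J b S : In S (charge c R J b) -> c <= b /\ S = mkstate R J (b - c).
Proof. unfold charge. destruct (Nat.leb_spec c b); simpl; intuition. Qed.

Lemma in_charge_intro c R J b : c <= b -> In (mkstate R J (b - c)) (charge c R J b).
Proof. intro H; unfold charge. destruct (Nat.leb_spec c b); [left; auto | lia]. Qed.

Lemma index_rule_decreases R a s rest J b S : In S (index_rule R a s rest J b) ->
  budget S < b /\ stack_load (jobs S) <= stack_load ((a, s :: rest) :: J) + 1.
Proof.
  destruct a; destruct s; simpl; try contradiction; intro H;
    apply in_charge in H as [H1 ->]; simpl; lia.
Qed.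

Lemma index_step_decreases R a σ J b S : σ <> [] -> In S (index_step R a σ J b) ->
  budget S < b.
Proof.
  destruct σ as [|s rest]; [congruence|]. intros _. unfold index_step.
  destruct (classify R s) as [p X| s' |]; try contradiction.
  - destruct X; try contradiction. intro H. apply in_flat_map in H as (q & _ & H).
    apply index_rule_decreases in H; tauto.
  - intro H; apply index_rule_decreases in H; tauto.
Qed.

Definition advances (S : state) (R : tm nt) (a : tm path) (σ : list (tm path))
  (J : list job) (b : nat) : Prop :=
  budget S < b \/
  (budget S = b /\ stack_load (jobs S) = stack_load ((a, σ) :: J) + 1) \/
  (σ = [] /\ budget S = b /\ stack_load (jobs S) = stack_load ((a, σ) :: J) /\
   pat S = R /\ jobs_size R (jobs S) < psize R a + jobs_size R J).

Lemma node_step_advances R a σ J b S : In S (node_step R a σ J b) -> advances S R a σ J b.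
Proof.
  unfold advances. destruct a; simpl; try contradiction; intro H.
  - apply in_charge in H as [H1 ->]. simpl.
    destruct σ; simpl in *; [right; right | left; lia]. repeat split; auto; lia.
  - destruct H as [<-|[]]. simpl. right; left; split; auto; lia.
  - apply in_charge in H as [H1 ->]. simpl.
    destruct σ; simpl in *; [right; right | left; lia]. repeat split; auto; lia.
  - destruct σ as [|s rest].
    + destruct H as [<-|[]]. simpl. right; right. repeat split; auto; lia.
    + left. eapply index_step_decreases; eauto. congruence.
  - destruct σ as [|s rest].
    + destruct H as [<-|[]]. simpl. right; right. repeat split; auto; lia.
    + left. eapply index_step_decreases; eauto. congruence.
Qed.

Lemma hole_step_empty_decreases pr R p X J b S : subterm R p = Some (Var X) ->
  In S (hole_step pr R p X [] J b) -> lex3 (rank S) (rank (mkstate R ((Var p, []) :: J) b)).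
Proof.
  intros Ep H; unfold hole_step in H; cbv beta iota in H; unfold rank.
  destruct X as [| | |j].
  - apply in_map_iff in H as (j & <- & Hj). apply in_seq in Hj. simpl.
    destruct j as [|j]; [|left; lia].
    right. split; [lia|]. right. split; [lia|].
    rewrite (jobs_size_graft_var R p NT (NG 0) J Ep), Ep. simpl. lia.
  - contradiction.
  - destruct H as [<-|[]]. simpl. right. split; [lia|]. right. split; [lia|].
    rewrite Ep; simpl; lia.
  - apply in_charge in H as [H1 ->]. simpl. destruct j as [|j]; [|left; lia].
    right. split; [lia|]. right. split; [lia|]. rewrite Ep; simpl; lia.
Qed.

Lemma mstep_decreases pr S S' : In S' (mstep_pruned pr S) -> lex3 (rank S') (rank S).
Proof.
  destruct S as [R J b]. unfold mstep_pruned. rewrite filter_In. intros [H Hle].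
  apply Nat.leb_le in Hle. unfold mstep in H; cbn in H.
  destruct J as [|[a σ] J]; [contradiction|].
  destruct (classify R a) as [p X|a'|] eqn:Ec; try contradiction.
  - apply classify_hole in Ec as [-> Ep]. destruct σ as [|s σ'].
    + eapply hole_step_empty_decreases; eauto.
    + apply in_flat_map in H as (q & _ & H). apply node_step_advances in H.
      unfold advances, rank in *. destruct S' as [R' J' b']; simpl in *.
      destruct H as [H|[[H1 H2]|[H1 _]]]; try discriminate.
      * left; lia.
      * right. split; [lia|]. left. lia.
  - apply node_step_advances in H. unfold advances, rank in *.
    destruct S' as [R' J' b']; simpl in *.
    pose proof (psize_classify _ _ _ Ec) as Es.
    destruct H as [H|[[H1 H2]|(H0 & H1 & H2 & H3 & H4)]].
    + left; lia.
    + right. split; [lia|]. left. lia.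
    + subst. right. split; [lia|]. right. split; [lia|]. lia.
Qed.

Inductive narrows (pr : nat -> list (tm nt)) : state -> tm nt -> Prop :=
| narrows_done R : narrows pr (mkstate R [] 0) R
| narrows_step S S' R : In S' (mstep_pruned pr S) -> narrows pr S' R -> narrows pr S R.

Definition is_final (S : state) : bool :=
  match jobs S, budget S with [], 0 => true | _, _ => false end.

Lemma narrows_inv pr S R : narrows pr S R <->
  (is_final S = true /\ R = pat S) \/ exists S', In S' (mstep_pruned pr S) /\
  narrows pr S' R.
Proof.
  split.
  - intro H; inversion H; subst; [left; simpl; auto | right; eauto].
  - intros [[H1 ->]|(S' & H1 & H2)]; [|econstructor; eauto].
    destruct S as [R [|j J] [|b]]; simpl in H1; try discriminate. constructor.
Qed.

Definition collect_narrows (pr : nat -> list (tm nt)) (L : list state) :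
  (forall S, In S L -> {l : list (tm nt) | forall R, In R l <-> narrows pr S R}) ->
  {l : list (tm nt) | forall R, In R l <-> exists S, In S L /\ narrows pr S R}.
Proof.
  induction L as [|S0 L IH]; intro H.
  - exists []. intro R; split; [intros []| intros (S & [] & _)].
  - destruct (H S0 (or_introl eq_refl)) as [l0 Hl0].
    destruct (IH (fun S HS => H S (or_intror HS))) as [l1 Hl1].
    exists (l0 ++ l1). intro R. rewrite in_app_iff, Hl0, Hl1. split.
    + intros [H1|(S & H2 & H3)]; [exists S0 | exists S]; simpl; auto.
    + intros (S & [<-|H2] & H3); eauto.
Defined.

Definition enum_narrows (pr : nat -> list (tm nt)) (S : state) :
  {l : list (tm nt) | forall R, In R l <-> narrows pr S R}.
Proof.
  induction S as [S IH] using
    (well_founded_induction_type (wf_inverse_image state _ lex3 rank lex3_wf)).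
  destruct (collect_narrows pr (mstep_pruned pr S)
              (fun S' HS' => IH S' (mstep_decreases pr S S' HS'))) as [l Hl].
  exists ((if is_final S then [pat S] else []) ++ l).
  intro R. rewrite in_app_iff, Hl, narrows_inv.
  destruct (is_final S); simpl; intuition congruence.
Defined.

(** * Correctness of the symbolic machine *)

Inductive jobs_cost (g : gtm) : list job -> nat -> Prop :=
| jobs_cost_nil : jobs_cost g [] 0
| jobs_cost_cons a σ J c1 c2 : cost (inst g a) (map (inst g) σ) c1 -> jobs_cost g J c2 ->
    jobs_cost g ((a, σ) :: J) (c1 + c2).

Lemma jobs_cost_cons_iff g a σ J b : jobs_cost g ((a, σ) :: J) b <->
  exists c1 c2, b = c1 + c2 /\ cost (inst g a) (map (inst g) σ) c1 /\ jobs_cost g J c2.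
Proof.
  split; intro H.
  - inversion H; subst; eauto.
  - destruct H as (c1 & c2 & -> & H1 & H2); constructor; auto.
Qed.

Lemma jobs_cost_nil_iff g b : jobs_cost g [] b <-> b = 0.
Proof. split; intro H; [inversion H; auto | subst; constructor]. Qed.

Lemma jobs_cost_ge_load g J b : jobs_cost g J b -> stack_load J <= b.
Proof.
  induction 1; simpl; auto. apply cost_ge_length in H. rewrite length_map in H. lia.
Qed.

Lemma jobs_cost_head g a a' σ σ' J b : inst g a = inst g a' ->
  map (inst g) σ = map (inst g) σ' ->
  jobs_cost g ((a, σ) :: J) b -> jobs_cost g ((a', σ') :: J) b.
Proof. intros E1 E2 H. rewrite jobs_cost_cons_iff in *. rewrite <- E1, <- E2. auto. Qed.

Definition not_NS (X : nt) : Prop := match X with NS => False | _ => True end.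

Definition at_most_level (j : nat) (X : nt) : Prop :=
  match X with NG i => i <= j | _ => True end.

Record level_spec (j : nat) (ps : list (tm nt)) : Prop := {
  level_sound : forall β t, In β ps -> matches β t -> nt_lang (NG j) t;
  level_complete : forall t, nt_lang (NG j) t -> exists β, In β ps /\ matches β t;
  level_disjoint : forall β1 β2 t, In β1 ps -> In β2 ps ->
    matches β1 t -> matches β2 t -> β1 = β2;
  level_shape : forall β, In β ps -> notvar β \/ β = Var NN;
  level_at_most : forall β, In β ps -> all_vars (at_most_level j) β }.

Record cases_spec (X : nt) (cs : list (tm nt)) : Prop := {
  cases_notvar : forall q, In q cs -> notvar q;
  cases_sound : forall q t, In q cs -> matches q t -> nt_lang X t;
  cases_complete : forall t, nt_lang X t -> exists q, In q cs /\ matches q t;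
  cases_disjoint : forall q1 q2 t, In q1 cs -> In q2 cs ->
    matches q1 t -> matches q2 t -> q1 = q2 }.

Ltac destruct_in :=
  repeat match goal with
  | H : In _ [] |- _ => destruct H
  | H : In _ (_ :: _) |- _ => destruct H as [<-|H]
  | H : _ = _ \/ _ |- _ => destruct H as [<-|H]
  | H : False |- _ => destruct H
  end.

Lemma cases_S_spec : cases_spec NS cases_S.
Proof.
  unfold cases_S; split.
  - intros q Hq; destruct_in; exact I.
  - intros q t Hq Hm; destruct_in; destruct t; simpl in *; try contradiction;
      constructor; auto.
  - intros t Ht. destruct Ht.
    + exists (Slash (Var NT)); simpl; auto.
    + exists (Lift (Var NS)); simpl; auto.
    + exists Shift; simpl; auto.
  - intros q1 q2 t H1 H2 M1 M2; destruct_in; auto; destruct t; simpl in *; contradiction.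
Qed.

Lemma cases_N_spec : cases_spec NN cases_N.
Proof.
  unfold cases_N; split.
  - intros q Hq; destruct_in; exact I.
  - intros q t Hq Hm; destruct_in; destruct t; simpl in *; try contradiction;
      constructor; auto.
  - intros t Ht. destruct Ht.
    + exists Zero; simpl; auto.
    + exists (Succ (Var NN)); simpl; auto.
  - intros q1 q2 t H1 H2 M1 M2; destruct_in; auto; destruct t; simpl in *; contradiction.
Qed.

Lemma cases_T_spec : cases_spec NT cases_T.
Proof.
  unfold cases_T; split.
  - intros q Hq; destruct_in; exact I.
  - intros q t Hq Hm; destruct_in; destruct t; simpl in *; try contradiction.
    + apply tm_idx; constructor.
    + apply tm_idx; constructor; auto.
    + apply tm_lam; auto.
    + apply tm_app; tauto.
    + apply tm_clos; tauto.
  - intros t Ht. apply is_term_inv in Ht. destruct t; try contradiction.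
    + exists (App (Var NT) (Var NT)); simpl; tauto.
    + exists (Clos (Var NT) (Var NS)); simpl; tauto.
    + exists (Lam (Var NT)); simpl; tauto.
    + exists (Succ (Var NN)); simpl; tauto.
    + exists Zero; simpl; tauto.
  - intros q1 q2 t H1 H2 M1 M2; destruct_in; auto; destruct t; simpl in *; contradiction.
Qed.

Lemma in_cases_G pr j q : In q (cases_G pr j) ->
  exists β, In β (pr j) /\ In q (expand_N β) /\ (forall t, matches q t -> matches β t).
Proof.
  intros Hq. apply in_flat_map in Hq as (β & H1 & H2).
  exists β; split; auto; split; auto.
  destruct β as [[| | |i]| | | | | | | |]; simpl in H2;
    try (destruct H2 as [<-|[]]; auto; fail); try contradiction.
  intros t Ht. exact (cases_sound _ _ cases_N_spec q t H2 Ht).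
Qed.

Lemma cases_G_spec pr j : level_spec j (pr j) -> cases_spec (NG j) (cases_G pr j).
Proof.
  intros [Hsound Hcomplete Hdisj Hshape _]. split.
  - intros q Hq. destruct (in_cases_G pr j q Hq) as (β & H1 & H2 & _).
    destruct (Hshape β H1) as [Hn| ->].
    + destruct β; simpl in *; try contradiction; destruct H2 as [<-|[]]; exact I.
    + simpl in H2. destruct H2 as [<-|[<-|[]]]; exact I.
  - intros q t Hq Hm. destruct (in_cases_G pr j q Hq) as (β & H1 & H2 & H3). eauto.
  - intros t Ht. destruct (Hcomplete t Ht) as (β & H1 & H2).
    destruct (Hshape β H1) as [Hn| ->].
    + exists β; split; auto. apply in_flat_map. exists β; split; auto.
      destruct β; simpl in *; try contradiction; auto.
    + destruct (cases_complete _ _ cases_N_spec t H2) as (q & Hq & Hm).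
      exists q; split; auto. apply in_flat_map. exists (Var NN); split; auto.
  - intros q1 q2 t H1 H2 M1 M2.
    destruct (in_cases_G pr j q1 H1) as (β1 & B1 & E1 & F1).
    destruct (in_cases_G pr j q2 H2) as (β2 & B2 & E2 & F2).
    assert (β1 = β2) as <- by eauto.
    destruct (Hshape β1 B1) as [Hn| ->].
    + destruct β1; simpl in *; try contradiction;
        destruct E1 as [<-|[]]; destruct E2 as [<-|[]]; auto.
    + eapply (cases_disjoint _ _ cases_N_spec); eauto.
Qed.

Lemma cases_G_at_most pr j q : level_spec j (pr j) -> In q (cases_G pr j) ->
  all_vars (at_most_level j) q.
Proof.
  intros Hj Hq. destruct (in_cases_G pr j q Hq) as (β & H1 & H2 & _).
  destruct (level_shape _ _ Hj β H1) as [Hn| ->].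
  - destruct β; simpl in *; try contradiction; destruct H2 as [<-|[]];
      apply (level_at_most _ _ Hj); auto.
  - simpl in H2. destruct H2 as [<-|[<-|[]]]; exact I.
Qed.

Definition jobs_defined (R : tm nt) (J : list job) : Prop :=
  Forall (fun jb => all_vars (defined_at R) (fst jb) /\
                    Forall (all_vars (defined_at R)) (snd jb)) J.

Definition below (k : nat) (R : tm nt) : Prop :=
  all_vars (fun X => match X with NG j => j < k | _ => True end) R.

Lemma jobs_defined_impl R R' J : (forall p, defined_at R p -> defined_at R' p) ->
  jobs_defined R J -> jobs_defined R' J.
Proof.
  intros H. apply Forall_impl. intros [a σ] [H1 H2]; simpl in *. split.
  - eapply all_vars_impl; eauto.
  - eapply Forall_impl; [|eauto]. intros; eapply all_vars_impl; eauto.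
Qed.

Definition is_index_head (a : tm path) : Prop :=
  match a with Zero | Succ _ => True | _ => False end.

Lemma cost_head_shape t σ c : cost t σ c ->
  match t with Slash _ | Lift _ | Shift | Var _ => False | _ => True end.
Proof. destruct 1; auto. Qed.

Lemma cost_index_stack_head t s σ c : cost t (s :: σ) c ->
  match t with
  | Zero | Succ _ => match s with Slash _ | Lift _ | Shift => True | _ => False end
  | _ => True
  end.
Proof. intro H; inversion H; subst; auto. Qed.

Lemma job_hole_not_NS R g p X σ J b : matches R g -> subterm R p = Some (Var X) ->
  jobs_cost g ((Var p, σ) :: J) b -> not_NS X.
Proof.
  intros HM Ep HJ. destruct (matches_subterm _ _ _ _ HM Ep) as (g' & Eg & Hv).
  apply jobs_cost_cons_iff in HJ as (c1 & c2 & _ & HC & _). simpl in HC.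
  rewrite (gsubterm_eq _ _ _ Eg) in HC. apply cost_head_shape in HC.
  destruct X; simpl; auto. simpl in Hv. destruct Hv; auto.
Qed.

Lemma index_stack_hole_is_NS R g p X a rest J b : is_index_head a -> matches R g ->
  subterm R p = Some (Var X) -> jobs_cost g ((a, Var p :: rest) :: J) b -> X = NS.
Proof.
  intros Ha HM Ep HJ. destruct (matches_subterm _ _ _ _ HM Ep) as (g' & Eg & Hv).
  apply jobs_cost_cons_iff in HJ as (c1 & c2 & _ & HC & _). simpl in HC.
  rewrite (gsubterm_eq _ _ _ Eg) in HC. apply cost_index_stack_head in HC.
  assert (Hg' : match g' with Slash _ | Lift _ | Shift => True | _ => False end)
    by (destruct a; simpl in Ha; try contradiction; exact HC).
  destruct X as [| | |j]; auto; exfalso; simpl in Hv;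
    [apply is_term_inv in Hv | | apply proj1, is_term_inv in Hv];
    destruct g'; try contradiction; inversion Hv.
Qed.

Lemma index_rule_pat R a s rest J b S' : In S' (index_rule R a s rest J b) -> pat S' = R.
Proof.
  destruct a; destruct s; simpl; try contradiction; intro H;
    apply in_charge in H as [_ ->]; auto.
Qed.

Lemma index_rule_unique R a s rest J b S1 S2 : In S1 (index_rule R a s rest J b) ->
  In S2 (index_rule R a s rest J b) -> S1 = S2.
Proof.
  destruct a; destruct s; simpl; try contradiction; intros H1 H2;
    apply in_charge in H1 as [_ ->]; apply in_charge in H2 as [_ ->]; auto.
Qed.

Lemma index_rule_sound R a s rest J b S' g : In S' (index_rule R a s rest J b) ->
  jobs_cost g (jobs S') (budget S') -> jobs_cost g ((a, s :: rest) :: J) b.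
Proof.
  destruct a; destruct s; simpl; try contradiction; intro H;
    apply in_charge in H as [H1 ->]; simpl; intro HJ; rewrite jobs_cost_cons_iff in *;
    destruct HJ as (c1 & c2 & E & HC & HJ); exists (S c1), c2;
    (split; [lia | split; [simpl in *; constructor; auto | auto]]).
Qed.

Lemma index_rule_complete R a s rest J b g : is_index_head a -> notvar s ->
  jobs_cost g ((a, s :: rest) :: J) b -> exists S', In S' (index_rule R a s rest J b) /\
  jobs_cost g (jobs S') (budget S').
Proof.
  intros Ha Hs HJ. rewrite jobs_cost_cons_iff in HJ. destruct HJ as (c1 & c2 & E & HC & HJ).
  destruct a; simpl in Ha; try contradiction; destruct s; simpl in Hs; try contradiction;
    simpl in HC; inversion HC; subst;
    (eexists; split; [cbn [index_rule]; apply in_charge_intro; lia|]);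
    simpl; match goal with |- jobs_cost _ _ ?x => replace x with (c + c2) by lia end;
    constructor; auto.
Qed.

Lemma index_rule_defined R a s rest J b S' : In S' (index_rule R a s rest J b) ->
  all_vars (defined_at R) a -> all_vars (defined_at R) s ->
  Forall (all_vars (defined_at R)) rest -> jobs_defined R J -> jobs_defined R (jobs S').
Proof.
  destruct a; destruct s; simpl; try contradiction; intro H;
    apply in_charge in H as [H1 ->]; simpl; intros Ha Hs Hr HJ; constructor; auto; simpl in *; split; auto;
    repeat (constructor; simpl; auto).
Qed.

Lemma index_step_refines R a σ J b S' g : In S' (index_step R a σ J b) ->
  matches (pat S') g -> matches R g.
Proof.
  destruct σ as [|s rest]; unfold index_step; cbv beta iota.
  - intros [<-|[]]; auto.
  - destruct (classify R s) as [p X|s'|] eqn:Ec; try contradiction.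
    + destruct X; try contradiction. intro H. apply in_flat_map in H as (q & Hq & H).
      apply index_rule_pat in H. rewrite H. apply classify_hole in Ec as [-> Ep].
      eapply matches_graft_inv; eauto. intros t Ht. eapply (cases_sound _ _ cases_S_spec);
        eauto.
    + intro H. apply index_rule_pat in H. rewrite H; auto.
Qed.

Lemma index_step_sound R a σ J b S' g : is_index_head a -> In S' (index_step R a σ J b) ->
  matches (pat S') g ->
  jobs_cost g (jobs S') (budget S') -> jobs_cost g ((a, σ) :: J) b.
Proof.
  intros Ha. destruct σ as [|s rest]; unfold index_step; cbv beta iota.
  - intros [<-|[]] _. simpl. intro HJ. replace b with (0 + b) by lia.
    constructor; auto. destruct a; simpl in Ha; try contradiction; constructor.
  - destruct (classify R s) as [p X|s'|] eqn:Ec; try contradiction.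
    + destruct X; try contradiction. intro H. apply in_flat_map in H as (q & Hq & H).
      intros HM HJ. pose proof (index_rule_pat _ _ _ _ _ _ _ H) as ER.
      pose proof (index_rule_sound _ _ _ _ _ _ _ g H HJ) as H'. clear H. rename H' into H.
      apply classify_hole in Ec as [-> Ep].
      eapply jobs_cost_head; [reflexivity| |exact H]. simpl. f_equal.
      rewrite ER in HM. erewrite inst_expose; eauto. eapply subterm_graft; eauto.
    + intros H HM HJ. pose proof (index_rule_pat _ _ _ _ _ _ _ H) as ER.
      pose proof (index_rule_sound _ _ _ _ _ _ _ g H HJ) as H'. clear H.
      destruct (classify_con _ _ _ Ec) as (E1 & _ & _).
      eapply jobs_cost_head; [reflexivity| |exact H']. simpl. f_equal. apply E1.
      rewrite ER in HM; auto.
Qed.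

Lemma index_step_unique R a σ J b S1 S2 g : In S1 (index_step R a σ J b) ->
  In S2 (index_step R a σ J b) ->
  matches (pat S1) g -> matches (pat S2) g -> S1 = S2.
Proof.
  destruct σ as [|s rest]; unfold index_step; cbv beta iota.
  - intros [<-|[]] [<-|[]]; auto.
  - destruct (classify R s) as [p X|s'|] eqn:Ec; try contradiction.
    + destruct X; try contradiction. apply classify_hole in Ec as [-> Ep].
      intros H1 H2 M1 M2.
      apply in_flat_map in H1 as (q1 & Hq1 & H1). apply in_flat_map in H2 as (q2 & Hq2 & H2).
      pose proof (index_rule_pat _ _ _ _ _ _ _ H1) as E1.
        pose proof (index_rule_pat _ _ _ _ _ _ _ H2) as E2.
      rewrite E1 in M1; rewrite E2 in M2.
      destruct (matches_graft_subterm _ _ _ _ _ Ep M1) as (g1 & F1 & N1).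
      destruct (matches_graft_subterm _ _ _ _ _ Ep M2) as (g2 & F2 & N2).
      rewrite F1 in F2; injection F2 as <-.
      assert (q1 = q2) as <- by (eapply (cases_disjoint _ _ cases_S_spec); eauto).
      eapply index_rule_unique; eauto.
    + intros; eapply index_rule_unique; eauto.
Qed.

Lemma index_step_complete R a σ J b g : is_index_head a -> matches R g ->
  jobs_cost g ((a, σ) :: J) b ->
  Forall (all_vars (defined_at R)) σ ->
  exists S', In S' (index_step R a σ J b) /\ matches (pat S') g /\
  jobs_cost g (jobs S') (budget S').
Proof.
  intros Ha HM HJ HP. destruct σ as [|s rest]; unfold index_step; cbv beta iota.
  - exists (mkstate R J b); split; [left; auto|]. simpl; split; auto.
    rewrite jobs_cost_cons_iff in HJ. destruct HJ as (c1 & c2 & -> & HC & HJ).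
    destruct a; simpl in Ha; try contradiction; simpl in HC; inversion HC; subst; auto.
  - inversion HP as [|x y Hs Hr]; subst.
    destruct (classify R s) as [p X|s'|] eqn:Ec.
    + apply classify_hole in Ec as [-> Ep].
      assert (X = NS) as -> by (eapply index_stack_hole_is_NS; eauto).
      destruct (matches_subterm _ _ _ _ HM Ep) as (g' & Eg & Hv).
      destruct (cases_complete _ _ cases_S_spec g' Hv) as (q & Hq & Hm).
      assert (HM' : matches (graft R p q) g) by (eapply matches_graft; eauto).
      destruct (index_rule_complete (graft R p q) a (expose p q) rest J b g)
        as (S' & H1 & H2); auto.
      { apply notvar_expose. eapply (cases_notvar _ _ cases_S_spec); eauto. }
      { eapply jobs_cost_head; [reflexivity| |exact HJ]. simpl. f_equal.
        erewrite inst_expose; eauto. eapply subterm_graft; eauto. }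
      exists S'; split; [apply in_flat_map; eauto|]. split; auto.
      rewrite (index_rule_pat _ _ _ _ _ _ _ H1); auto.
    + destruct (classify_con _ _ _ Ec) as (E1 & E2 & E3).
      destruct (index_rule_complete R a s' rest J b g) as (S' & H1 & H2); auto.
      { eapply jobs_cost_head; [reflexivity| |exact HJ]. simpl. f_equal. symmetry;
        apply E1; auto. }
      exists S'; split; auto. split; auto. rewrite (index_rule_pat _ _ _ _ _ _ _ H1); auto.
    + exfalso. eapply classify_bad; eauto.
Qed.

Lemma index_step_defined R a σ J b S' : In S' (index_step R a σ J b) ->
  all_vars (defined_at R) a -> Forall (all_vars (defined_at R)) σ -> jobs_defined R J ->
  jobs_defined (pat S') (jobs S') /\ (forall p, defined_at R p -> defined_at (pat S') p).
Proof.
  destruct σ as [|s rest]; unfold index_step; cbv beta iota.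
  - intros [<-|[]]; simpl; auto.
  - intros H Ha Hσ HJ. inversion Hσ as [|x y Hs Hr]; subst.
    destruct (classify R s) as [p X|s'|] eqn:Ec; try contradiction.
    + destruct X; try contradiction. apply classify_hole in Ec as [-> Ep].
      apply in_flat_map in H as (q & Hq & H).
      pose proof (index_rule_pat _ _ _ _ _ _ _ H) as ER.
      pose proof (defined_at_graft R p _ q Ep) as Hok.
      rewrite ER. split; auto.
      eapply index_rule_defined; eauto.
      * eapply all_vars_impl; eauto.
      * eapply all_vars_expose. eapply subterm_graft; eauto.
      * eapply Forall_impl; [|exact Hr]. intros; eapply all_vars_impl; eauto.
      * eapply jobs_defined_impl; eauto.
    + destruct (classify_con _ _ _ Ec) as (E1 & E2 & E3).
      pose proof (index_rule_pat _ _ _ _ _ _ _ H) as ER. rewrite ER. split; auto.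
      eapply index_rule_defined; eauto.
Qed.

Lemma index_step_below k R a σ J b S' : In S' (index_step R a σ J b) -> below k R ->
  below k (pat S').
Proof.
  destruct σ as [|s rest]; unfold index_step; cbv beta iota.
  - intros [<-|[]]; simpl; auto.
  - intros H HR. destruct (classify R s) as [p X|s'|] eqn:Ec; try contradiction.
    + destruct X; try contradiction.
      apply in_flat_map in H as (q & Hq & H).
      rewrite (index_rule_pat _ _ _ _ _ _ _ H). apply all_vars_graft; auto.
      unfold cases_S in Hq; destruct_in; simpl; auto.
    + rewrite (index_rule_pat _ _ _ _ _ _ _ H); auto.
Qed.

Lemma map_inst_lift g σ : map (inst g) (map Lift σ) = map Lift (map (inst g) σ).
Proof. rewrite !map_map. reflexivity. Qed.

Lemma node_step_refines R a σ J b S' g : In S' (node_step R a σ J b) ->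
  matches (pat S') g -> matches R g.
Proof.
  destruct a; simpl; try contradiction.
  - intro H; apply in_charge in H as [_ ->]; auto.
  - intros [<-|[]]; auto.
  - intro H; apply in_charge in H as [_ ->]; auto.
  - apply index_step_refines.
  - apply index_step_refines.
Qed.

Lemma node_step_sound R a σ J b S' g : In S' (node_step R a σ J b) -> matches (pat S') g ->
  jobs_cost g (jobs S') (budget S') -> jobs_cost g ((a, σ) :: J) b.
Proof.
  destruct a; cbn [node_step]; try contradiction.
  - intro H; apply in_charge in H as [H1 ->]. simpl. intros _ HJ.
    rewrite jobs_cost_cons_iff in HJ. destruct HJ as (c1 & c' & E1 & HC1 & HJ).
    rewrite jobs_cost_cons_iff in HJ. destruct HJ as (c2 & c3 & E2 & HC2 & HJ).
    rewrite jobs_cost_cons_iff. exists (length σ + c1 + c2), c3. split; [lia|]. split; auto.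
    simpl. pose proof (cost_app _ _ _ _ _ HC1 HC2) as HH.
    rewrite length_map in HH. exact HH.
  - intros [<-|[]]. simpl. intros _ HJ.
    rewrite jobs_cost_cons_iff in *. destruct HJ as (c1 & c2 & E & HC & HJ).
    exists c1, c2; split; auto. split; auto. simpl. constructor. auto.
  - intro H; apply in_charge in H as [H1 ->]. simpl. intros _ HJ.
    rewrite jobs_cost_cons_iff in *. destruct HJ as (c1 & c2 & E & HC & HJ).
    exists (length σ + c1), c2; split; [lia|]. split; auto.
    simpl. rewrite map_inst_lift in HC. pose proof (cost_lam _ _ _ HC) as HH.
    rewrite length_map in HH. exact HH.
  - intros; eapply index_step_sound; eauto; simpl; auto.
  - intros; eapply index_step_sound; eauto; simpl; auto.
Qed.

Lemma node_step_unique R a σ J b S1 S2 g : In S1 (node_step R a σ J b) ->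
  In S2 (node_step R a σ J b) ->
  matches (pat S1) g -> matches (pat S2) g -> S1 = S2.
Proof.
  destruct a; cbn [node_step]; try contradiction.
  - intros H1 H2; apply in_charge in H1 as [_ ->]; apply in_charge in H2 as [_ ->]; auto.
  - intros [<-|[]] [<-|[]]; auto.
  - intros H1 H2; apply in_charge in H1 as [_ ->]; apply in_charge in H2 as [_ ->]; auto.
  - apply index_step_unique.
  - apply index_step_unique.
Qed.

Lemma node_step_complete R a σ J b g : notvar a -> matches R g ->
  jobs_cost g ((a, σ) :: J) b ->
  all_vars (defined_at R) a -> Forall (all_vars (defined_at R)) σ ->
  exists S', In S' (node_step R a σ J b) /\ matches (pat S') g /\
  jobs_cost g (jobs S') (budget S').
Proof.
  intros Hv HM HJ Ha Hσ.
  rewrite jobs_cost_cons_iff in HJ. destruct HJ as (c1 & c2 & E & HC & HJ).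
  destruct a; simpl in Hv; try contradiction; cbn [node_step].
  - simpl in HC. apply cost_app_iff in HC as (d1 & d2 & Ed & H1 & H2).
    rewrite length_map in Ed.
    exists (mkstate R ((a1, σ) :: (a2, σ) :: J) (b - length σ)).
    split; [apply in_charge_intro; lia|]. simpl. split; auto.
    replace (b - length σ) with (d1 + (d2 + c2)) by lia.
    constructor; auto. constructor; auto.
  - simpl in HC. rewrite cost_clos_iff in HC.
    exists (mkstate R ((a1, a2 :: σ) :: J) b). split; [left; auto|].
    simpl. split; auto. subst. constructor; auto.
  - simpl in HC. apply cost_lam_iff in HC as (d & Ed & H1).
    rewrite length_map in Ed. rewrite <- map_inst_lift in H1.
    exists (mkstate R ((a, map Lift σ) :: J) (b - length σ)).
    split; [apply in_charge_intro; lia|]. simpl. split; auto.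
    replace (b - length σ) with (d + c2) by lia. constructor; auto.
  - simpl in HC; apply cost_head_shape in HC; contradiction.
  - simpl in HC; apply cost_head_shape in HC; contradiction.
  - eapply index_step_complete; eauto; simpl; auto. subst. constructor; auto.
  - simpl in HC; apply cost_head_shape in HC; contradiction.
  - eapply index_step_complete; eauto; simpl; auto. subst. constructor; auto.
Qed.

Lemma node_step_defined R a σ J b S' : In S' (node_step R a σ J b) ->
  all_vars (defined_at R) a -> Forall (all_vars (defined_at R)) σ -> jobs_defined R J ->
  jobs_defined (pat S') (jobs S') /\ (forall p, defined_at R p -> defined_at (pat S') p).
Proof.
  destruct a; cbn [node_step]; try contradiction.
  - intro H; apply in_charge in H as [_ ->]. simpl. intros [H1 H2] Hσ HJ.
    split; auto. constructor; [simpl; auto|]. constructor; [simpl; auto|]. auto.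
  - intros [<-|[]]. simpl. intros [H1 H2] Hσ HJ.
    split; auto. constructor; [simpl; auto|]. auto.
  - intro H; apply in_charge in H as [_ ->]. simpl. intros H1 Hσ HJ.
    split; auto. constructor; [simpl; split; auto|]. 2: auto.
    apply Forall_map. eapply Forall_impl; [|exact Hσ]. simpl; auto.
  - intros; eapply index_step_defined; eauto.
  - intros; eapply index_step_defined; eauto.
Qed.

Lemma node_step_below k R a σ J b S' : In S' (node_step R a σ J b) -> below k R ->
  below k (pat S').
Proof.
  destruct a; cbn [node_step]; try contradiction.
  - intro H; apply in_charge in H as [_ ->]; auto.
  - intros [<-|[]]; auto.
  - intro H; apply in_charge in H as [_ ->]; auto.
  - apply index_step_below.
  - apply index_step_below.
Qed.

Lemma node_step_guard R a σ J b S' : In S' (node_step R a σ J b) -> σ <> [] ->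
  Forall (fun jb => snd jb <> []) J -> budget S' < b \/
  Forall (fun jb => snd jb <> []) (jobs S').
Proof.
  intros H Hσ HJ. destruct a; cbn [node_step] in H; try contradiction.
  - apply in_charge in H as [H1 ->]. left. simpl.
    destruct σ; [congruence|]. simpl in *; lia.
  - destruct H as [<-|[]]. right. simpl. constructor; auto. simpl; congruence.
  - apply in_charge in H as [H1 ->]. left. simpl.
    destruct σ; [congruence|]. simpl in *; lia.
  - left. eapply index_step_decreases; eauto.
  - left. eapply index_step_decreases; eauto.
Qed.

Section Hole.
Variable pr : nat -> list (tm nt).
Variable k : nat.
Hypothesis Hpr : forall j, j < k -> level_spec j (pr j).

Lemma hole_cases_spec R p X : below k R -> subterm R p = Some (Var X) -> not_NS X ->
  cases_spec X (hole_cases pr X).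
Proof.
  intros HR Ep HX. destruct X; simpl in *; try contradiction.
  - apply cases_T_spec.
  - apply cases_N_spec.
  - apply cases_G_spec. apply Hpr. exact (all_vars_subterm _ R p _ HR Ep).
Qed.

Lemma hole_cases_below R p X q : below k R -> subterm R p = Some (Var X) ->
  In q (hole_cases pr X) -> below k q.
Proof.
  intros HR Ep Hq. unfold below. destruct X; simpl in Hq.
  - unfold cases_T in Hq; destruct_in; simpl; auto.
  - contradiction.
  - unfold cases_N in Hq; destruct_in; simpl; auto.
  - pose proof (all_vars_subterm _ R p _ HR Ep) as Hj. simpl in Hj.
    eapply all_vars_impl; [|eapply cases_G_at_most; eauto].
    intros [| | |i]; simpl; auto. lia.
Qed.

Lemma hole_step_refines R p X σ J b S' g : below k R -> subterm R p = Some (Var X) ->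
  In S' (hole_step pr R p X σ J b) -> matches (pat S') g -> matches R g.
Proof.
  intros HR Ep. destruct σ as [|s σ']; unfold hole_step; cbv beta iota.
  - destruct X.
    + intro H; apply in_map_iff in H as (j & <- & _). simpl. intro HM.
      eapply matches_graft_inv; eauto. intros t [Ht _]; exact Ht.
    + contradiction.
    + intros [<-|[]]; auto.
    + intro H; apply in_charge in H as [_ ->]; auto.
  - intros H HM. apply in_flat_map in H as (q & Hq & H).
    assert (HX : not_NS X) by (destruct X; simpl in *; auto).
    eapply matches_graft_inv; [exact Ep | | eapply node_step_refines; eauto].
    intros t; apply (cases_sound _ _ (hole_cases_spec R p X HR Ep HX)); auto.
Qed.

Lemma hole_step_sound R p X σ J b S' g : below k R -> subterm R p = Some (Var X) ->
  In S' (hole_step pr R p X σ J b) -> matches (pat S') g ->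
  jobs_cost g (jobs S') (budget S') ->
  jobs_cost g ((Var p, σ) :: J) b.
Proof.
  intros HR Ep. destruct σ as [|s σ']; unfold hole_step; cbv beta iota.
  - destruct X as [| | |n].
    + intro H; apply in_map_iff in H as (j & <- & Hj). apply in_seq in Hj.
      simpl. intros HM HJ.
      destruct (matches_graft_subterm _ _ _ _ _ Ep HM) as (g' & Eg & [_ Hc]).
      replace b with (j + (b - j)) by lia. constructor; auto.
      simpl. rewrite (gsubterm_eq _ _ _ Eg). auto.
    + contradiction.
    + intros [<-|[]]. simpl. intros HM HJ.
      destruct (matches_subterm _ _ _ _ HM Ep) as (g' & Eg & Hv).
      replace b with (0 + b) by lia. constructor; auto.
      simpl. rewrite (gsubterm_eq _ _ _ Eg). apply cost_index; auto.
    + intro H; apply in_charge in H as [Hj ->]. simpl. intros HM HJ.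
      destruct (matches_subterm _ _ _ _ HM Ep) as (g' & Eg & [_ Hc]).
      replace b with (n + (b - n)) by lia. constructor; auto.
      simpl. rewrite (gsubterm_eq _ _ _ Eg). auto.
  - intros H HM HJ. apply in_flat_map in H as (q & Hq & H).
    pose proof (node_step_refines _ _ _ _ _ _ _ H HM) as HM'.
    pose proof (node_step_sound _ _ _ _ _ _ _ H HM HJ) as HJ'.
    eapply jobs_cost_head; [| reflexivity | exact HJ']. simpl.
    erewrite inst_expose; eauto. eapply subterm_graft; eauto.
Qed.

Lemma hole_step_unique R p X σ J b S1 S2 g : below k R -> subterm R p = Some (Var X) ->
  In S1 (hole_step pr R p X σ J b) -> In S2 (hole_step pr R p X σ J b) ->
  matches (pat S1) g -> matches (pat S2) g -> S1 = S2.
Proof.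
  intros HR Ep. destruct σ as [|s σ']; unfold hole_step; cbv beta iota.
  - destruct X.
    + intros H1 H2 M1 M2.
      apply in_map_iff in H1 as (j1 & <- & _). apply in_map_iff in H2 as (j2 & <- & _).
      simpl in *.
      destruct (matches_graft_subterm _ _ _ _ _ Ep M1) as (g1 & F1 & [_ C1]).
      destruct (matches_graft_subterm _ _ _ _ _ Ep M2) as (g2 & F2 & [_ C2]).
      rewrite F1 in F2; injection F2 as <-.
      rewrite (cost_functional _ _ _ _ C1 C2). auto.
    + contradiction.
    + intros [<-|[]] [<-|[]]; auto.
    + intros H1 H2; apply in_charge in H1 as [_ ->]; apply in_charge in H2 as [_ ->]; auto.
  - intros H1 H2 M1 M2.
    apply in_flat_map in H1 as (q1 & Hq1 & H1). apply in_flat_map in H2 as (q2 & Hq2 & H2).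
    assert (HX : not_NS X) by (destruct X; simpl in *; auto).
    pose proof (node_step_refines _ _ _ _ _ _ _ H1 M1) as M1'.
    pose proof (node_step_refines _ _ _ _ _ _ _ H2 M2) as M2'.
    destruct (matches_graft_subterm _ _ _ _ _ Ep M1') as (g1 & F1 & N1).
    destruct (matches_graft_subterm _ _ _ _ _ Ep M2') as (g2 & F2 & N2).
    rewrite F1 in F2; injection F2 as <-.
    assert (q1 = q2) as <-.
    { eapply (cases_disjoint _ _ (hole_cases_spec R p X HR Ep HX)); eauto. }
    eapply node_step_unique; eauto.
Qed.

Lemma hole_step_complete R p X σ J b g : below k R -> subterm R p = Some (Var X) ->
  matches R g -> jobs_cost g ((Var p, σ) :: J) b -> Forall (all_vars (defined_at R)) σ ->
  exists S', In S' (hole_step pr R p X σ J b) /\ matches (pat S') g /\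
  jobs_cost g (jobs S') (budget S').
Proof.
  intros HR Ep HM HJ Hσ.
  destruct (matches_subterm _ _ _ _ HM Ep) as (g' & Eg & Hv). simpl in Hv.
  pose proof HJ as HJ0.
  rewrite jobs_cost_cons_iff in HJ. destruct HJ as (c1 & c2 & E & HC & HJ).
  simpl in HC. rewrite (gsubterm_eq _ _ _ Eg) in HC.
  assert (HX : not_NS X) by (eapply job_hole_not_NS; eauto).
  destruct σ as [|s σ']; unfold hole_step; cbv beta iota.
  - destruct X as [| | |n]; simpl in HX; try contradiction.
    + exists (mkstate (graft R p (Var (NG c1))) J (b - c1)). split.
      * apply in_map_iff. exists c1; split; auto. apply in_seq. lia.
      *  simpl. split.
        -- eapply matches_graft; eauto. simpl. split; auto.
        -- replace (b - c1) with c2 by lia. auto.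
    + exists (mkstate R J b). split; [left; auto|]. simpl. split; auto.
      rewrite (cost_functional _ _ _ _ HC (cost_index _ Hv)) in E. simpl in E. subst; auto.
    + destruct Hv as [_ Hc]. rewrite (cost_functional _ _ _ _ HC Hc) in E. subst.
      exists (mkstate R J (n + c2 - n)). split; [apply in_charge_intro; lia|].
      simpl. split; auto. replace (n + c2 - n) with c2 by lia; auto.
  - destruct (cases_complete _ _ (hole_cases_spec R p X HR Ep HX) g' Hv) as (q & Hq & Hm).
    assert (HM' : matches (graft R p q) g) by (eapply matches_graft; eauto).
    assert (Hsub : subterm (graft R p q) p = Some q) by (eapply subterm_graft; eauto).
    destruct (node_step_complete (graft R p q) (expose p q) (s :: σ') J b g)
      as (S' & H1 & H2); auto.
    + apply notvar_expose. eapply (cases_notvar _ _ (hole_cases_spec R p X HR Ep HX));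
        eauto.
    + eapply jobs_cost_head; [| reflexivity | exact HJ0]. simpl.
      erewrite inst_expose; eauto.
    + eapply all_vars_expose; eauto.
    + eapply Forall_impl; [|exact Hσ]. intros; eapply all_vars_impl; [|eauto].
      eapply defined_at_graft; eauto.
    + exists S'; split; auto. apply in_flat_map; eauto.
Qed.

Lemma hole_step_defined R p X σ J b S' : subterm R p = Some (Var X) ->
  In S' (hole_step pr R p X σ J b) -> Forall (all_vars (defined_at R)) σ ->
  jobs_defined R J ->
  jobs_defined (pat S') (jobs S') /\ (forall p', defined_at R p' -> defined_at (pat S') p').
Proof.
  intros Ep. destruct σ as [|s σ']; unfold hole_step; cbv beta iota.
  - destruct X.
    + intro H; apply in_map_iff in H as (j & <- & _). simpl. intros _ HJ.
      pose proof (defined_at_graft R p _ (Var (NG j)) Ep) as Hok.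
      split; auto. eapply jobs_defined_impl; eauto.
    + contradiction.
    + intros [<-|[]]; simpl; auto.
    + intro H; apply in_charge in H as [_ ->]; simpl; auto.
  - intros H Hσ HJ. apply in_flat_map in H as (q & Hq & H).
    pose proof (defined_at_graft R p _ q Ep) as Hok.
    destruct (node_step_defined _ _ _ _ _ _ H) as [H1 H2].
    + eapply all_vars_expose. eapply subterm_graft; eauto.
    + eapply Forall_impl; [|exact Hσ]. intros; eapply all_vars_impl; eauto.
    + eapply jobs_defined_impl; eauto.
    + split; auto.
Qed.

Lemma hole_step_below R p X σ J b S' : below k R -> subterm R p = Some (Var X) ->
  In S' (hole_step pr R p X σ J b) -> (σ = [] -> b < k) -> below k (pat S').
Proof.
  intros HR Ep. destruct σ as [|s σ']; unfold hole_step; cbv beta iota.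
  - intros H Hb. specialize (Hb eq_refl). destruct X.
    + apply in_map_iff in H as (j & <- & Hj). apply in_seq in Hj. simpl.
      apply all_vars_graft; auto. simpl. lia.
    + contradiction.
    + destruct H as [<-|[]]; auto.
    + apply in_charge in H as [_ ->]; auto.
  - intros H _. apply in_flat_map in H as (q & Hq & H).
    eapply node_step_below; eauto. apply all_vars_graft; auto. eapply hole_cases_below;
      eauto.
Qed.

Lemma hole_step_guard R p X σ J b S' : In S' (hole_step pr R p X σ J b) -> σ <> [] ->
  Forall (fun jb => snd jb <> []) J -> budget S' < b \/
  Forall (fun jb => snd jb <> []) (jobs S').
Proof.
  intros H Hσ HJ. destruct σ as [|s σ']; [congruence|].
  unfold hole_step in H; cbv beta iota in H.
  apply in_flat_map in H as (q & Hq & H). eapply node_step_guard; eauto.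
Qed.

End Hole.

Lemma index_step_notvar R a σ J b S' : In S' (index_step R a σ J b) -> notvar R ->
  notvar (pat S').
Proof.
  destruct σ as [|s rest]; unfold index_step; cbv beta iota.
  - intros [<-|[]]; simpl; auto.
  - intros H HR. destruct (classify R s) as [p X|s'|] eqn:Ec; try contradiction.
    + destruct X; try contradiction. apply classify_hole in Ec as [-> Ep].
      apply in_flat_map in H as (q & Hq & H).
      rewrite (index_rule_pat _ _ _ _ _ _ _ H). eapply notvar_graft; eauto.
    + rewrite (index_rule_pat _ _ _ _ _ _ _ H); auto.
Qed.

Lemma node_step_notvar R a σ J b S' : In S' (node_step R a σ J b) -> notvar R ->
  notvar (pat S').
Proof.
  destruct a; cbn [node_step]; try contradiction.
  - intro H; apply in_charge in H as [_ ->]; auto.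
  - intros [<-|[]]; auto.
  - intro H; apply in_charge in H as [_ ->]; auto.
  - apply index_step_notvar.
  - apply index_step_notvar.
Qed.

Lemma hole_step_notvar pr R p X σ J b S' : subterm R p = Some (Var X) ->
  In S' (hole_step pr R p X σ J b) -> notvar R -> notvar (pat S').
Proof.
  intros Ep. destruct σ as [|s σ']; unfold hole_step; cbv beta iota.
  - destruct X.
    + intro H; apply in_map_iff in H as (j & <- & _). simpl. intro.
      eapply notvar_graft; eauto.
    + contradiction.
    + intros [<-|[]]; auto.
    + intro H; apply in_charge in H as [_ ->]; auto.
  - intros H HR. apply in_flat_map in H as (q & Hq & H).
    eapply node_step_notvar; eauto. eapply notvar_graft; eauto.
Qed.

Section Steps.
Variable pr : nat -> list (tm nt).
Variable k : nat.
Hypothesis Hpr : forall j, j < k -> level_spec j (pr j).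

(** [inv_guard]: a [T]-hole is closed by [G_j] with [j <= budget] only under
    an empty stack, and the budget drops below [k] before any stack empties;
    hence final patterns only mention [G_j] with [j < k]. *)
Record machine_inv (S : state) : Prop := {
  inv_defined : jobs_defined (pat S) (jobs S);
  inv_below : below k (pat S);
  inv_notvar : notvar (pat S);
  inv_budget : budget S <= k;
  inv_guard : budget S < k \/ Forall (fun jb => snd jb <> []) (jobs S) }.

Definition realizes (S : state) (g : gtm) : Prop :=
  matches (pat S) g /\ jobs_cost g (jobs S) (budget S).

Lemma mstep_sound S S' g : machine_inv S -> In S' (mstep pr S) ->
  realizes S' g -> realizes S g.
Proof.
  destruct S as [R J b]. intros [HP HH _ _ _]. unfold realizes in *; simpl in *.
  destruct J as [|[a σ] J]; [contradiction|]. cbn [mstep jobs pat budget].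
  destruct (classify R a) as [p X|a'|] eqn:Ec; try contradiction.
  - apply classify_hole in Ec as [-> Ep]. intros H [HM HJ].
    split; [eapply hole_step_refines; eauto | eapply hole_step_sound; eauto].
  - intros H [HM HJ]. pose proof (node_step_refines _ _ _ _ _ _ _ H HM) as HM'.
    split; auto. pose proof (node_step_sound _ _ _ _ _ _ _ H HM HJ) as HJ'.
    destruct (classify_con _ _ _ Ec) as (E1 & _ & _).
    eapply jobs_cost_head; [ | reflexivity | exact HJ']. apply E1; auto.
Qed.

Lemma mstep_unique S S1 S2 g : machine_inv S -> In S1 (mstep pr S) -> In S2 (mstep pr S) ->
  matches (pat S1) g -> matches (pat S2) g -> S1 = S2.
Proof.
  destruct S as [R J b]. intros [HP HH _ _ _]. simpl in *.
  destruct J as [|[a σ] J]; [contradiction|]. cbn [mstep jobs pat budget].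
  destruct (classify R a) as [p X|a'|] eqn:Ec; try contradiction.
  - apply classify_hole in Ec as [-> Ep]. intros. eapply hole_step_unique; eauto.
  - intros. eapply node_step_unique; eauto.
Qed.

Lemma mstep_complete S g : machine_inv S -> realizes S g -> jobs S <> [] ->
  exists S', In S' (mstep_pruned pr S) /\ realizes S' g.
Proof.
  destruct S as [R J b]. intros [HP HH _ _ _] [HM HJ] Hne. unfold realizes; simpl in *.
  destruct J as [|[a σ] J]; [congruence|].
  inversion HP as [|x y [Ha Hσ] HPJ]; subst. simpl in Ha, Hσ.
  assert (exists S', In S' (mstep pr (mkstate R ((a, σ) :: J) b)) /\
                     matches (pat S') g /\ jobs_cost g (jobs S') (budget S'))
    as (S' & H1 & H2 & H3).
  { cbn [mstep jobs pat budget]. destruct (classify R a) as [p X|a'|] eqn:Ec.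
    - apply classify_hole in Ec as [-> Ep]. eapply hole_step_complete; eauto.
    - destruct (classify_con _ _ _ Ec) as (E1 & E2 & E3).
      eapply node_step_complete; eauto.
      eapply jobs_cost_head; [ | reflexivity | exact HJ]. symmetry; auto.
    - exfalso; eapply classify_bad; eauto. }
  exists S'. split; [|split; auto]. apply filter_In. split; auto.
  apply Nat.leb_le. apply jobs_cost_ge_load in H3. auto.
Qed.

Lemma mstep_budget S S' : In S' (mstep_pruned pr S) -> budget S' <= budget S.
Proof. intro H. apply mstep_decreases in H. destruct H as [H|[H _]]; lia. Qed.

Lemma mstep_inv S S' : machine_inv S -> In S' (mstep_pruned pr S) -> machine_inv S'.
Proof.
  intros HI0 H. pose proof (mstep_budget _ _ H) as Hb.
  apply filter_In in H as [H _].
  destruct S as [R J b]. destruct HI0 as [HP HH HN Hk HB]; simpl in *.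
  destruct J as [|[a σ] J]; [contradiction|].
  inversion HP as [|x y [Ha Hσ] HPJ]; subst. simpl in Ha, Hσ.
  assert (Hσb : σ = [] -> b < k).
  { intros ->. destruct HB as [HB|HB]; auto. inversion HB; subst. simpl in *. congruence. }
  assert (HB' : b < k \/ σ <> [] /\ Forall (fun jb => snd jb <> []) J).
  { destruct HB as [HB|HB]; [left; lia|]. inversion HB; subst; auto. }
  cbn [mstep jobs pat budget] in H.
  destruct (classify R a) as [p X|a'|] eqn:Ec; try contradiction.
  - apply classify_hole in Ec as [-> Ep]. split.
    + eapply hole_step_defined; eauto.
    + eapply hole_step_below; eauto.
    + eapply hole_step_notvar; eauto.
    + lia.
    + destruct HB' as [HB'|[Hne HB']]; [left; lia|].
      destruct (hole_step_guard pr R p X σ J b S' H Hne HB'); [left; lia | right; auto].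
  - destruct (classify_con _ _ _ Ec) as (E1 & E2 & E3). split.
    + eapply node_step_defined; eauto.
    + eapply node_step_below; eauto.
    + eapply node_step_notvar; eauto.
    + lia.
    + destruct HB' as [HB'|[Hne HB']]; [left; lia|].
      destruct (node_step_guard R a' σ J b S' H Hne HB'); [left; lia | right; auto].
Qed.

Lemma narrows_sound S R g : narrows pr S R -> machine_inv S -> matches R g -> realizes S g.
Proof.
  induction 1 as [R|S S' R H1 H2 IH]; intros HI0 HM.
  - split; auto. constructor.
  - apply (mstep_sound S S' g HI0).
    + apply filter_In in H1; tauto.
    + apply IH; auto. eapply mstep_inv; eauto.
Qed.

Lemma narrows_complete S g : machine_inv S -> realizes S g ->
  exists R, narrows pr S R /\ matches R g.
Proof.
  induction S as [S IH] using
    (well_founded_ind (wf_inverse_image state _ lex3 rank lex3_wf)).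
  intros HI0 HG. destruct S as [R J b]. destruct J as [|jb J].
  - destruct HG as [HM HJ]. simpl in HJ. apply jobs_cost_nil_iff in HJ. subst.
    exists R. split; [constructor | auto].
  - destruct (mstep_complete _ g HI0 HG) as (S' & H1 & H2); [simpl; congruence|].
    destruct (IH S' (mstep_decreases _ _ _ H1) (mstep_inv _ _ HI0 H1) H2) as (R' & H3 & H4).
    exists R'. split; auto. econstructor; eauto.
Qed.

Lemma narrows_unique S R1 R2 g : narrows pr S R1 -> machine_inv S -> narrows pr S R2 ->
  matches R1 g -> matches R2 g -> R1 = R2.
Proof.
  induction 1 as [R|S S1 R1 H1 H2 IH]; intros HI0 HN2 M1 M2.
  - inversion HN2; subst; auto. contradiction.
  - inversion HN2 as [R|S0 S2 R2' H3 H4]; subst; [contradiction|].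
    assert (HI1 : machine_inv S1) by (eapply mstep_inv; eauto).
    assert (HI2 : machine_inv S2) by exact (mstep_inv S S2 HI0 H3).
    destruct (narrows_sound _ _ _ H2 HI1 M1) as [N1 _].
    destruct (narrows_sound _ _ _ H4 HI2 M2) as [N2 _].
    assert (S1 = S2) as <-.
    { apply filter_In in H1 as [H1 _]. apply filter_In in H3 as [H3 _].
      exact (mstep_unique S S1 S2 g HI0 H1 H3 N1 N2). }
    eapply IH; eauto.
Qed.

Lemma narrows_shape S R : narrows pr S R -> machine_inv S -> below k R /\ notvar R.
Proof.
  induction 1 as [R|S S' R H1 H2 IH]; intros HI0.
  - destruct HI0; auto.
  - apply IH. eapply mstep_inv; eauto.
Qed.

End Steps.

(** * The productions of [G_k] *)

(** Closure productions are the final patterns of the machine started on the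
    job [T[S]] (that is, [Var [0]] under the stack [[Var [1]]]) with budget [k]. *)
Definition init_state (k : nat) : state :=
  mkstate (Clos (Var NT) (Var NS)) [(Var [0], [Var [1]])] k.

Definition closure_prods (pr : nat -> list (tm nt)) (k : nat) : list (tm nt) :=
  proj1_sig (enum_narrows pr (init_state k)).

Lemma in_closure_prods pr k β : In β (closure_prods pr k) <-> narrows pr (init_state k) β.
Proof. unfold closure_prods. destruct (enum_narrows pr (init_state k)) as [l Hl].
  apply Hl. Qed.

Definition base_prods (k : nat) : list (tm nt) :=
  Lam (Var (NG k)) :: map (fun i => App (Var (NG i)) (Var (NG (k - i)))) (seq 0 (S k)) ++
  (if k =? 0 then [Var NN] else []).

Definition level_from (pr : nat -> list (tm nt)) (k : nat) : list (tm nt) :=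
  base_prods k ++ closure_prods pr k.

Fixpoint levels (n : nat) : list (list (tm nt)) :=
  match n with
  | 0 => [level_from (fun _ => []) 0]
  | S m => levels m ++ [level_from (fun j => nth j (levels m) []) (S m)]
  end.

Definition level_prods (n : nat) : list (tm nt) := nth n (levels n) [].

Definition lower_prods (k : nat) : nat -> list (tm nt) :=
  match k with 0 => fun _ => [] | S m => fun j => nth j (levels m) [] end.

Lemma levels_length n : length (levels n) = S n.
Proof. induction n; simpl; auto. rewrite length_app, IHn. simpl. lia. Qed.

Lemma nth_levels n j : j <= n -> nth j (levels n) [] = level_prods j.
Proof.
  induction n; intros Hj.
  - assert (j = 0) as -> by lia. reflexivity.
  - destruct (Nat.eq_dec j (S n)) as [->|Hne]; [reflexivity|].
    simpl. rewrite app_nth1 by (rewrite levels_length; lia). apply IHn. lia.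
Qed.

Lemma level_prods_eq k : level_prods k = level_from (lower_prods k) k.
Proof.
  destruct k; unfold level_prods; simpl; auto.
  rewrite app_nth2 by (rewrite levels_length; lia). rewrite levels_length, Nat.sub_diag.
  reflexivity.
Qed.

Lemma lower_prods_eq k j : j < k -> lower_prods k j = level_prods j.
Proof. destruct k; simpl; intro H; [lia|]. apply nth_levels. lia. Qed.

Lemma in_base_prods k β : In β (base_prods k) ->
  β = Lam (Var (NG k)) \/ (exists i, i <= k /\ β = App (Var (NG i)) (Var (NG (k - i)))) \/
  (k = 0 /\ β = Var NN).
Proof.
  unfold base_prods. intros [<-|H]; auto. apply in_app_iff in H as [H|H].
  - apply in_map_iff in H as (i & <- & Hi). apply in_seq in Hi.
    right; left. exists i; split; auto; lia.
  - destruct (Nat.eqb_spec k 0); simpl in H; try contradiction. destruct H as [<-|[]]; auto.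
Qed.

Lemma base_prods_sound k β t : In β (base_prods k) -> matches β t -> nt_lang (NG k) t.
Proof.
  intros H HM. apply in_base_prods in H as [->|[(i & Hi & ->)|[-> ->]]]; simpl in *.
  - destruct t; simpl in HM; try contradiction. destruct HM as [H1 H2].
    split; [apply tm_lam; auto|]. apply (cost_lam _ [] k). auto.
  - destruct t; simpl in HM; try contradiction. destruct HM as [[H1 H2] [H3 H4]].
    split; [apply tm_app; auto|].
    replace k with (length (@nil gtm) + i + (k - i)) by (simpl; lia).
    constructor; auto.
  - split; [apply tm_idx; auto | apply cost_index; auto].
Qed.

Section Level.
Variable pr : nat -> list (tm nt).
Variable k : nat.
Hypothesis Hpr : forall j, j < k -> level_spec j (pr j).

Lemma init_state_inv : machine_inv k (init_state k).
Proof.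
  split; cbn; auto.
  - repeat constructor; unfold defined_at; cbn; congruence.
  - right. repeat constructor. cbn. congruence.
Qed.

Lemma realizes_init_state g : realizes (init_state k) g <->
  exists a s, g = Clos a s /\ is_term a /\ is_subst s /\ cost g [] k.
Proof.
  unfold realizes, init_state; simpl. split.
  - intros [HM HJ]. destruct g; simpl in HM; try contradiction. destruct HM as [H1 H2].
    exists g1, g2. do 3 (split; auto).
    rewrite jobs_cost_cons_iff in HJ. destruct HJ as (c1 & c2 & E & HC & HJ).
    apply jobs_cost_nil_iff in HJ. subst. unfold gsubterm in HC; simpl in HC.
    constructor. rewrite Nat.add_0_r. auto.
  - intros (a & s & -> & H1 & H2 & H3). simpl. split; auto.
    rewrite <- (Nat.add_0_r k). constructor; [|constructor].
    unfold gsubterm; simpl. apply cost_clos_iff; auto.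
Qed.

Lemma closure_prods_sound β t : In β (closure_prods pr k) -> matches β t ->
  exists a s, t = Clos a s /\ is_term a /\ is_subst s /\ cost t [] k.
Proof.
  intros H HM. apply in_closure_prods in H. apply realizes_init_state.
  eapply (narrows_sound pr k Hpr); eauto. apply init_state_inv.
Qed.

Lemma closure_prods_complete a s : is_term a -> is_subst s -> cost (Clos a s) [] k ->
  exists β, In β (closure_prods pr k) /\ matches β (Clos a s).
Proof.
  intros H1 H2 H3.
  destruct (narrows_complete pr k Hpr (init_state k) (Clos a s) init_state_inv)
    as (β & HN & HM).
  - apply realizes_init_state. eauto 10.
  - exists β; split; auto. apply in_closure_prods; auto.
Qed.

Lemma closure_prods_disjoint β1 β2 t : In β1 (closure_prods pr k) ->
  In β2 (closure_prods pr k) -> matches β1 t -> matches β2 t -> β1 = β2.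
Proof.
  intros H1 H2 M1 M2. apply in_closure_prods in H1, H2.
  eapply (narrows_unique pr k Hpr); eauto. apply init_state_inv.
Qed.

Lemma closure_prods_shape β : In β (closure_prods pr k) -> below k β /\ notvar β.
Proof.
  intro H. apply in_closure_prods in H.
  eapply (narrows_shape pr k Hpr); eauto. apply init_state_inv.
Qed.

Lemma level_from_sound β t : In β (level_from pr k) -> matches β t -> nt_lang (NG k) t.
Proof.
  intros H HM. apply in_app_iff in H as [H|H].
  - eapply base_prods_sound; eauto.
  - destruct (closure_prods_sound β t H HM) as (a & s & -> & H1 & H2 & H3).
    split; auto. apply tm_clos; auto.
Qed.

Lemma level_from_complete t : nt_lang (NG k) t -> exists β, In β (level_from pr k) /\
  matches β t.
Proof.
  intros [Ht Hc]. apply is_term_inv in Ht as Ht'. unfold level_from, base_prods.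
  destruct t; simpl in Ht'; try contradiction.
  - apply cost_app_iff in Hc as (c1 & c2 & E & H1 & H2). simpl in E.
    exists (App (Var (NG c1)) (Var (NG (k - c1)))). split.
    + apply in_app_iff; left. right. apply in_app_iff; left.
      apply in_map_iff. exists c1; split; auto. apply in_seq; lia.
    + simpl. replace (k - c1) with c2 by lia. tauto.
  - destruct Ht' as [H1 H2]. destruct (closure_prods_complete t1 t2 H1 H2 Hc) as (β & Hb & Hm).
    exists β; split; auto. apply in_app_iff; right; auto.
  - apply cost_lam_iff in Hc as (c & E & H1). simpl in E; subst.
    exists (Lam (Var (NG c))); split; [left; auto|]. simpl; auto.
  - inversion Hc; subst. exists (Var NN). split; [|simpl; auto].
    apply in_app_iff; left. right. apply in_app_iff; right. simpl; auto.
  - inversion Hc; subst. exists (Var NN). split; [|simpl; auto].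
    apply in_app_iff; left. right. apply in_app_iff; right. simpl; auto.
Qed.

Lemma level_from_head β t : In β (level_from pr k) -> matches β t ->
  (β = Lam (Var (NG k)) /\ exists u, t = Lam u) \/
  ((exists i, β = App (Var (NG i)) (Var (NG (k - i)))) /\ exists u v, t = App u v) \/
  (β = Var NN /\ is_index t) \/
  (In β (closure_prods pr k) /\ exists a s, t = Clos a s).
Proof.
  intros H HM. apply in_app_iff in H as [H|H].
  - apply in_base_prods in H as [->|[(i & Hi & ->)|[-> ->]]].
    + left. split; auto. destruct t; simpl in HM; try contradiction; eauto.
    + right; left. split; eauto. destruct t; simpl in HM; try contradiction; eauto.
    + right; right; left. split; auto.
  - right; right; right. split; auto.
    destruct (closure_prods_sound β t H HM) as (a & s & -> & _). eauto.
Qed.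

(** Productions of [G_k] are told apart by the head constructor of the term,
    and two applications [G_i G_(k-i)] by the cost of the function part. *)
Lemma level_from_disjoint β1 β2 t : In β1 (level_from pr k) -> In β2 (level_from pr k) ->
  matches β1 t -> matches β2 t -> β1 = β2.
Proof.
  intros H1 H2 M1 M2.
  destruct (level_from_head β1 t H1 M1)
    as [[-> (u & ->)]|[[(i & ->) (u & v & ->)]|[[-> Hx]|[Hn (a & s & ->)]]]];
  destruct (level_from_head β2 _ H2 M2)
    as [[-> (u' & E)]|[[(i' & ->) (u' & v' & E)]|[[-> Hx']|[Hn' (a' & s' & E)]]]];
    try discriminate; auto; try (subst; inversion Hx; fail); try (subst; inversion Hx';
      fail).
  - destruct M1 as [[_ C1] _], M2 as [[_ C2] _].
    rewrite (cost_functional _ _ _ _ C1 C2). auto.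
  - eapply closure_prods_disjoint; eauto.
Qed.

Lemma level_from_spec : level_spec k (level_from pr k).
Proof.
  split.
  - apply level_from_sound.
  - apply level_from_complete.
  - apply level_from_disjoint.
  - intros β H. apply in_app_iff in H as [H|H].
    + apply in_base_prods in H as [->|[(i & Hi & ->)|[-> ->]]]; simpl; auto.
    + left. apply closure_prods_shape; auto.
  - intros β H. apply in_app_iff in H as [H|H].
    + apply in_base_prods in H as [->|[(i & Hi & ->)|[-> ->]]]; simpl; auto. split; lia.
    + apply closure_prods_shape in H as [H _]. eapply all_vars_impl; [|exact H].
      intros [| | |j]; simpl; auto. lia.
Qed.

End Level.

Theorem level_prods_spec k : level_spec k (level_prods k).
Proof.
  induction k as [k IH] using (well_founded_induction lt_wf).
  rewrite level_prods_eq. apply level_from_spec.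
  intros j Hj. rewrite lower_prods_eq; auto.
Qed.

(** * Derivations in a correct grammar *)

Lemma inb_In p P : inb p P = true <-> In p P.
Proof. unfold inb. destruct (in_dec prod_eq_dec p P); split; auto; discriminate. Qed.

(** [production_unit] makes every unit production be followed by one that
    consumes a constructor, which is what the inductions on the size of the
    derived term need. *)
Record grammar_spec (scope : nt -> Prop) (P : productions) : Prop := {
  production_sound : forall X β t, In (X, β) P -> matches β t -> nt_lang X t;
  production_complete : forall X t, scope X -> nt_lang X t ->
    exists β, In (X, β) P /\ matches β t /\ all_vars scope β;
  production_disjoint : forall X β1 β2 t, In (X, β1) P -> In (X, β2) P ->
    matches β1 t -> matches β2 t -> β1 = β2;
  production_unit : forall X Y β, In (X, Var Y) P -> In (Y, β) P -> notvar β }.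

Section Derivations.
Variable scope : nt -> Prop.
Variable P : productions.
Hypothesis HP : grammar_spec scope P.

Lemma deriv_sound β t : deriv P β t -> matches β t.
Proof.
  induction 1; simpl; auto. apply inb_In in e. eapply production_sound; eauto.
Qed.

Lemma deriv_var X β t : In (X, β) P -> deriv P β t -> deriv P (Var X) t.
Proof. intros H d. apply (d_var _ X β t); auto. apply inb_In; auto. Qed.

Lemma deriv_of_matches β t : matches β t -> all_vars scope β ->
  (forall X t', tsize t' <= tsize t -> scope X -> nt_lang X t' ->
     inhabited (deriv P (Var X) t')) ->
  inhabited (deriv P β t).
Proof.
  revert t; induction β; intros t HM HA IH; destruct t; simpl in HM, HA;
    try contradiction; try (apply IH; auto; fail); try (do 2 constructor; fail).
  - destruct HM, HA.
    destruct (IHβ1 t1), (IHβ2 t2); auto; try (intros; apply IH; simpl; auto; lia).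
    do 2 constructor; auto.
  - destruct HM, HA.
    destruct (IHβ1 t1), (IHβ2 t2); auto; try (intros; apply IH; simpl; auto; lia).
    do 2 constructor; auto.
  - destruct (IHβ t); auto; [intros; apply IH; simpl; auto; lia|]. do 2 constructor; auto.
  - destruct (IHβ t); auto; [intros; apply IH; simpl; auto; lia|]. do 2 constructor; auto.
  - destruct (IHβ t); auto; [intros; apply IH; simpl; auto; lia|]. do 2 constructor; auto.
  - destruct (IHβ t); auto; [intros; apply IH; simpl; auto; lia|]. do 2 constructor; auto.
Qed.

Lemma deriv_of_matches_notvar β t : notvar β -> matches β t -> all_vars scope β ->
  (forall X t', tsize t' < tsize t -> scope X -> nt_lang X t' ->
     inhabited (deriv P (Var X) t')) ->
  inhabited (deriv P β t).
Proof.
  intros Hv HM HA IH. destruct β; destruct t; simpl in Hv, HM, HA; try contradiction;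
    try (do 2 constructor; fail).
  - destruct HM, HA. destruct (deriv_of_matches β1 t1), (deriv_of_matches β2 t2);
      auto; try (intros; apply IH; simpl; auto; lia).
    do 2 constructor; auto.
  - destruct HM, HA. destruct (deriv_of_matches β1 t1), (deriv_of_matches β2 t2);
      auto; try (intros; apply IH; simpl; auto; lia).
    do 2 constructor; auto.
  - destruct (deriv_of_matches β t); auto; [intros; apply IH; simpl; auto; lia|].
    do 2 constructor; auto.
  - destruct (deriv_of_matches β t); auto; [intros; apply IH; simpl; auto; lia|].
    do 2 constructor; auto.
  - destruct (deriv_of_matches β t); auto; [intros; apply IH; simpl; auto; lia|].
    do 2 constructor; auto.
  - destruct (deriv_of_matches β t); auto; [intros; apply IH; simpl; auto; lia|].
    do 2 constructor; auto.
Qed.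

Lemma deriv_complete X t : scope X -> nt_lang X t -> inhabited (deriv P (Var X) t).
Proof.
  revert X. induction t as [t IH] using
    (well_founded_induction (wf_inverse_image _ _ lt (@tsize novar) lt_wf)).
  intros X HX Ht.
  assert (Hlayer : forall β, matches β t -> all_vars scope β -> notvar β ->
                     inhabited (deriv P β t))
    by (intros; apply deriv_of_matches_notvar; auto; intros; apply IH; auto).
  destruct (production_complete _ _ HP X t HX Ht) as (β & Hβ & HM & HA).
  destruct β as [Y| | | | | | | |];
    [| destruct (Hlayer _ HM HA I) as [d]; constructor; eapply deriv_var; eauto ..].
  destruct (production_complete _ _ HP Y t HA HM) as (β' & Hβ' & HM' & HA').
  destruct (Hlayer β' HM' HA') as [d]; [eapply production_unit; eauto|].
  constructor. eapply deriv_var; [exact Hβ|]. eapply deriv_var; eauto.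
Qed.

Lemma deriv_unique_of_vars β t (d1 d2 : deriv P β t) :
  (forall X t', tsize t' <= tsize t -> forall e1 e2 : deriv P (Var X) t', e1 = e2) ->
  d1 = d2.
Proof.
  induction d1; intros H; dependent destruction d2;
    try reflexivity; [apply H; lia| ..];
    f_equal; first [apply IHd1 | apply IHd1_1 | apply IHd1_2];
    intros; apply H; simpl; lia.
Qed.

Lemma deriv_unique_notvar β t (d1 d2 : deriv P β t) : notvar β ->
  (forall X t', tsize t' < tsize t -> forall e1 e2 : deriv P (Var X) t', e1 = e2) ->
  d1 = d2.
Proof.
  intros Hv H. destruct d1; simpl in Hv; try contradiction; dependent destruction d2;
    try reflexivity; f_equal; apply deriv_unique_of_vars; intros; apply H; simpl; lia.
Qed.

Lemma deriv_var_unique X t :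
  (forall β, In (X, β) P -> forall d1 d2 : deriv P β t, d1 = d2) ->
  forall e1 e2 : deriv P (Var X) t, e1 = e2.
Proof.
  intros H e1 e2.
  dependent destruction e1. dependent destruction e2.
  rename e into i1, e3 into i2, e1 into d1, e2 into d2.
  assert (beta = beta0) as <-.
  { apply inb_In in i1, i2.
    eapply production_disjoint; eauto; eapply deriv_sound; eauto. }
  assert (i1 = i2) as <- by apply (UIP_dec bool_dec).
  f_equal. apply H. apply inb_In; auto.
Qed.

Theorem deriv_unique X t (e1 e2 : deriv P (Var X) t) : e1 = e2.
Proof.
  revert X e1 e2. induction t as [t IH] using
    (well_founded_induction (wf_inverse_image _ _ lt (@tsize novar) lt_wf)).
  assert (Hlayer : forall β, notvar β -> forall d1 d2 : deriv P β t, d1 = d2)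
    by (intros; apply deriv_unique_notvar; auto; intros; apply IH; auto).
  intros X. apply deriv_var_unique. intros [Y| | | | | | | |] HX; try (apply Hlayer;
    exact I).
  apply deriv_var_unique. intros β HY. apply Hlayer. eapply production_unit; eauto.
Qed.

End Derivations.

(** * The reduction grammars *)

Definition upsilon_grammar (n : nat) : productions :=
  Lambda_prods ++ flat_map (fun k => map (fun β => (NG k, β)) (level_prods k)) (seq 0 (S n)).

Lemma in_upsilon_grammar n X β : In (X, β) (upsilon_grammar n) <->
  In (X, β) Lambda_prods \/ (exists k, k <= n /\ X = NG k /\ In β (level_prods k)).
Proof.
  unfold upsilon_grammar. rewrite in_app_iff, in_flat_map. split.
  - intros [H|(k & Hk & H)]; auto. apply in_map_iff in H as (β' & E & H).
    injection E as <- <-. apply in_seq in Hk. right. exists k; split; [lia|]. auto.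
  - intros [H|(k & Hk & -> & H)]; auto. right. exists k. split; [apply in_seq; lia|].
    apply in_map_iff. eauto.
Qed.

Ltac destruct_Lambda H :=
  unfold Lambda_prods in H; simpl in H;
  repeat (destruct H as [H|H]; [injection H; intros; subst|]); try contradiction;
  try discriminate.

Lemma Lambda_prods_sound X β t : In (X, β) Lambda_prods -> matches β t -> nt_lang X t.
Proof.
  intros H HM. destruct_Lambda H; destruct t; simpl in *; try contradiction;
    try (destruct HM); auto using tm_idx, tm_lam, tm_app, tm_clos, sb_slash, sb_lift, sb_shift.
Qed.

Lemma Lambda_prods_disjoint X β1 β2 t : In (X, β1) Lambda_prods ->
  In (X, β2) Lambda_prods ->
  matches β1 t -> matches β2 t -> β1 = β2.
Proof.
  intros H1 H2 M1 M2. destruct_Lambda H1; destruct_Lambda H2; try discriminate; auto;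
    destruct t; simpl in M1, M2; try contradiction;
    solve [inversion M1 | inversion M2].
Qed.

Lemma Lambda_prods_shape X β : In (X, β) Lambda_prods ->
  X <> NN /\ notvar β \/ X = NT /\ β = Var NN \/ X = NN /\ notvar β.
Proof. intros H. destruct_Lambda H; simpl; auto; left; split; auto; discriminate. Qed.

Lemma Lambda_prods_NG k β : ~ In (NG k, β) Lambda_prods.
Proof. unfold Lambda_prods; simpl; intuition discriminate. Qed.

Lemma in_upsilon_grammar_NG n k β :
  In (NG k, β) (upsilon_grammar n) <-> k <= n /\ In β (level_prods k).
Proof.
  rewrite in_upsilon_grammar. split.
  - intros [H|(k' & H1 & E & H2)]; [apply Lambda_prods_NG in H; contradiction|].
    injection E as <-. auto.
  - intros [H1 H2]. right. eauto.
Qed.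

Lemma Lambda_prods_complete n X t : nt_lang X t -> (forall k, X <> NG k) ->
  exists β, In (X, β) Lambda_prods /\ matches β t /\ all_vars (nt_of n) β.
Proof.
  intros Ht HX. unfold Lambda_prods.
  destruct X as [| | |k]; [| | | destruct (HX k eq_refl)]; simpl in Ht.
  - apply is_term_inv in Ht as Ht'. destruct t; try contradiction.
    + exists (App (Var NT) (Var NT)); simpl; tauto.
    + exists (Clos (Var NT) (Var NS)); simpl; tauto.
    + exists (Lam (Var NT)); simpl; tauto.
    + exists (Var NN); simpl; auto 10.
    + exists (Var NN); simpl; auto 10.
  - destruct Ht.
    + exists (Slash (Var NT)); simpl; tauto.
    + exists (Lift (Var NS)); simpl; tauto.
    + exists Shift; simpl; tauto.
  - destruct Ht.
    + exists Zero; simpl; tauto.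
    + exists (Succ (Var NN)); simpl; tauto.
Qed.

Lemma level_prods_at_most_scope n k β : k <= n -> In β (level_prods k) ->
  all_vars (nt_of n) β.
Proof.
  intros Hk H. eapply all_vars_impl; [|exact (level_at_most _ _ (level_prods_spec k) β H)].
  intros [| | |i]; simpl; auto. lia.
Qed.

Theorem upsilon_grammar_spec n : grammar_spec (nt_of n) (upsilon_grammar n).
Proof.
  split.
  - intros X β t H. apply in_upsilon_grammar in H as [H|(k & _ & -> & H)].
    + apply Lambda_prods_sound; auto.
    + apply (level_sound _ _ (level_prods_spec k)); auto.
  - intros X t HX Ht. destruct X as [| | |k].
    1-3: destruct (Lambda_prods_complete n _ t Ht ltac:(intros ? E; discriminate E))
           as (β & H1 & H2 & H3);
         exists β; rewrite in_upsilon_grammar; auto.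
    destruct (level_complete _ _ (level_prods_spec k) t Ht) as (β & H1 & H2).
    exists β. split; [apply in_upsilon_grammar_NG; auto|].
    split; auto. eapply level_prods_at_most_scope; eauto.
  - intros [| | |k] β1 β2 t H1 H2 M1 M2.
    1-3: apply in_upsilon_grammar in H1 as [H1|(? & _ & ? & _)]; [|discriminate];
         apply in_upsilon_grammar in H2 as [H2|(? & _ & ? & _)]; [|discriminate];
         eapply Lambda_prods_disjoint; eauto.
    apply in_upsilon_grammar_NG in H1 as [_ H1], H2 as [_ H2].
    eapply (level_disjoint _ _ (level_prods_spec k)); eauto.
  - intros X Y β HX HY.
    assert (Y = NN) as ->.
    { apply in_upsilon_grammar in HX as [HX|(k & _ & -> & HX)].
      - apply Lambda_prods_shape in HX as [[_ []]|[[_ E]|[_ []]]]. congruence.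
      - destruct (level_shape _ _ (level_prods_spec k) _ HX) as [[]|E]. congruence. }
    apply in_upsilon_grammar in HY as [HY|(k & _ & E & _)]; [|discriminate].
    apply Lambda_prods_shape in HY as [[[] _]|[[E _]|[_ Hv]]]; auto; discriminate.
Qed.

Lemma upsilon_grammar_scoped n X α : In (X, α) (upsilon_grammar n) ->
  nt_of n X /\ forall Y, occurs Y α -> nt_of n Y.
Proof.
  intros H. apply in_upsilon_grammar in H as [H|(k & Hk & -> & H)].
  - split; [destruct_Lambda H; exact I|].
    intros Y HY. destruct_Lambda H; simpl in HY; intuition subst; exact I.
  - split; [exact Hk|]. intros Y HY.
    eapply occurs_all_vars; eauto. eapply level_prods_at_most_scope; eauto.
Qed.

Lemma level_prods_cases k α : In α (level_prods k) -> In α (base_prods k) \/ below k α.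
Proof.
  rewrite level_prods_eq. intro H. apply in_app_iff in H as [H|H]; auto.
  right. apply (closure_prods_shape (lower_prods k) k); auto.
  intros j Hj. rewrite lower_prods_eq; auto. apply level_prods_spec.
Qed.

Lemma level_prods_self_referencing k α : In α (level_prods k) -> occurs (NG k) α ->
  α = Lam (Var (NG k)) \/ α = App (Var (NG 0)) (Var (NG k)) \/
  α = App (Var (NG k)) (Var (NG 0)).
Proof.
  intros H Hocc. destruct (level_prods_cases k α H) as [Hb|Hb].
  - apply in_base_prods in Hb as [->|[(i & Hi & ->)|[_ ->]]]; simpl in Hocc; auto;
      [|discriminate].
    destruct Hocc as [E|E]; injection E as E.
    + right; right. subst i. rewrite Nat.sub_diag. auto.
    + right; left. assert (i = 0) as -> by lia. rewrite Nat.sub_0_r. auto.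
  - exfalso. pose proof (occurs_all_vars _ α (NG k) Hb Hocc). simpl in *. lia.
Qed.

Lemma level_prods_regular k α Y : In α (level_prods k) -> ~ occurs (NG k) α ->
  occurs Y α -> Y = NT \/ Y = NS \/ Y = NN \/ exists j, j < k /\ Y = NG j.
Proof.
  intros H Hn HY.
  pose proof (occurs_all_vars _ α Y (level_at_most _ _ (level_prods_spec k) α H) HY).
  destruct Y as [| | |i]; auto. right; right; right. exists i. split; auto.
  simpl in *. destruct (Nat.eq_dec i k); [subst; contradiction | lia].
Qed.

Theorem mainTheorem1 :
  { G : nat -> productions | forall n : nat, simple_RG n (G n) }.
Proof.
  exists upsilon_grammar. intro n. split; [split; [|split]|split].
  - apply upsilon_grammar_scoped.
  - intros p Hp. apply in_or_app. auto.
  - intros k Hk. split.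
    + intros t. apply (deriv_unique _ _ (upsilon_grammar_spec n)).
    + intro t. rewrite normalises_in_iff_cost. split.
      * intros [d]. exact (deriv_sound _ _ (upsilon_grammar_spec n) _ _ d).
      * intro H. apply (deriv_complete (nt_of n)); auto. apply upsilon_grammar_spec.
  - intros X α H Hocc. apply in_upsilon_grammar in H as [H|(k & _ & -> & H)]; auto.
    right. exists k. split; auto. apply level_prods_self_referencing; auto.
  - intros k α H Hn Y HY. apply in_upsilon_grammar_NG in H as [_ H].
    eapply level_prods_regular; eauto.
Qed.
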